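(* Let $p\in[1,\infty)\setminus\{4,6,8,\dots\}$. For any two isometric finite-dimensional subspaces $A,B$ of $L_p[0,1]$, $$\lambda(A\hookrightarrow L_p[0,1])=\lambda(B\hookrightarrow L_p[0,1]).$$
   Context: For a Banach space $X$ and a subspace $A\subset X$, $\lambda(A\hookrightarrow X)=\inf\{\|P\|: P:X\to A \text{ a bounded linear projection of } X \text{ onto } A\}$. Isometric means linearly isometric. *)

(* Defs.v *)
From HB Require Import structures.
From mathcomp Require Import all_boot all_order all_algebra.
From mathcomp Require Import all_classical all_reals all_analysis.
From mathcomp Require Import measurable_realfun ess_sup_inf.

Set Implicit Arguments.
Unset Strict Implicit.
Unset Printing Implicit Defensive.
Import Order.TTheory GRing.Theory Num.Theory.
Import numFieldNormedType.Exports.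
Local Open Scope classical_set_scope.
Local Open Scope ring_scope.

(* The library provides the carrier [LspaceType mu p1] of the space L_p(mu)
   (measurable functions modulo a.e. equality, with finite Lnorm) without any
   algebraic or topological structure; it is made here into a normed space over
   the reals, with pointwise operations on representatives. *)
Section Lspace_normedModType.
Context d (T : measurableType d) (R : realType).
Variables (mu : {measure set T -> \bar R}) (p : \bar R) (p1 : (1 <= p)%E).

Local Notation L := (LspaceType mu p1).
Local Notation ty := (LfunType mu p1).
Local Notation aeT := {mfun_ mu, T >-> measurableTypeR R}.

Lemma Lspace_reprP (u : L) : ((u : aeT) : T -> R) \in Lfun mu p.
Proof.
apply/andP; split; first exact: valP.
by rewrite inE /=; exact: Lebesgue_finite.
Qed.

Definition Lspace_repr (u : L) : ty := Lfun_Sub p1 (Lspace_reprP u).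

Lemma Lfun_measurableTypeR (f : ty) :
  (f : T -> measurableTypeR R) \in @mfun _ _ T (measurableTypeR R).
Proof. exact: mfunP. Qed.

Definition Lspace_mclass (f : ty) : aeT :=
  (\pi_(aeT) (mfun_Sub (Lfun_measurableTypeR f)))%qT.

Lemma Lspace_mclassP (f : ty) : (Lspace_mclass f : T -> R) = f %[ae mu].
Proof.
have /eqP := reprK (Lspace_mclass f).
by rewrite [X in _ == X]/Lspace_mclass eqmodE => /asboolP.
Qed.

Lemma ae_eq_Lnorm (f g : T -> R) : measurable_fun [set: T] f ->
  measurable_fun [set: T] g -> f = g %[ae mu] ->
  'N[mu]_p[EFin \o f]%E = 'N[mu]_p[EFin \o g]%E.
Proof.
move=> mf mg fg.
have mpow r (h : T -> R) : measurable_fun [set: T] h ->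
    measurable_fun [set: T] (fun x => `|(EFin \o h) x| `^ r)%E.
  move=> mh; rewrite (_ : (fun x => _) = EFin \o (fun x => `|h x| `^ r)).
    apply/measurable_EFinP.
    apply: (@measurableT_comp _ _ _ _ _ _ (@powR R ^~ r)) => //.
    exact: measurableT_comp.
  by [].
rewrite Lnorm.unlock.
case: p p1 => [r _| |].
- apply: (congr1 (fun z : \bar R => (z `^ r^-1)%E)).
  apply: (ge0_ae_eq_integral measurableT (mpow r f mf) (mpow r g mg)).
  + by move=> x _; rewrite poweR_ge0.
  + by move=> x _; rewrite poweR_ge0.
  + by apply: filterS fg => x /= /[apply] ->.
- move=> _; case: ifPn => // mu0; apply: eq_ess_sup.
  by apply: filterS fg => x /= /(_ I) ->.
- by [].
Qed.

Lemma Lspace_class_finite (f : ty) : finite_norm mu p (Lspace_mclass f).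
Proof.
have mclass : measurable_fun [set: T] (Lspace_mclass f : T -> R).
  by move=> mT B mB; exact: (measurable_funPT (repr (Lspace_mclass f))).
have mf : measurable_fun [set: T] (f : T -> R) by exact: measurable_funPT.
rewrite /finite_norm (ae_eq_Lnorm mclass mf (Lspace_mclassP f)).
exact: Lfunction_finite.
Qed.

HB.instance Definition _ (f : ty) :=
  isFinLebesgue.Build d T R mu p p1 (Lspace_mclass f) (Lspace_class_finite f).

Definition Lspace_class (f : ty) : L := Lspace_mclass f.

Lemma Lspace_classP (f : ty) :
  (Lspace_repr (Lspace_class f) : T -> R) = f %[ae mu].
Proof. exact: Lspace_mclassP. Qed.

Lemma Lspace_eq (u v : L) : (u : aeT) = (v : aeT) -> u = v.
Proof.
case: u v => [u [[uP]]] [v [[vP]]] /= uv; case: _ / uv in vP *.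
by rewrite (Prop_irrelevance uP vP).
Qed.

Lemma Lspace_eqP (u v : L) :
  (Lspace_repr u : T -> R) = Lspace_repr v %[ae mu] -> u = v.
Proof.
move=> uv; apply: Lspace_eq.
rewrite -[LHS]reprK -[RHS]reprK; apply/eqP; rewrite eqmodE.
exact/asboolP.
Qed.

Lemma Lspace_class_eq (f g : ty) : (f : T -> R) = g %[ae mu] ->
  Lspace_class f = Lspace_class g.
Proof.
move=> fg; apply: Lspace_eqP.
apply: ae_eq_trans (Lspace_classP f) _.
apply: ae_eq_trans fg _.
exact: ae_eq_sym (Lspace_classP g).
Qed.

Lemma Lspace_reprK (u : L) : Lspace_class (Lspace_repr u) = u.
Proof. by apply: Lspace_eqP; exact: Lspace_classP. Qed.

HB.instance Definition _ := gen_eqMixin L.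
HB.instance Definition _ := gen_choiceMixin L.

Definition Lspace_add (u v : L) : L :=
  Lspace_class (Lspace_repr u + Lspace_repr v).
Definition Lspace_opp (u : L) : L := Lspace_class (- Lspace_repr u).
Definition Lspace_scale (a : R) (u : L) : L := Lspace_class (a *: Lspace_repr u).
Definition Lspace_zero : L := Lspace_class 0.
Definition Lspace_norm (u : L) : R := fine ('N[mu]_p[EFin \o Lspace_repr u]%E).

Lemma Lspace_classD (f g : ty) :
  Lspace_add (Lspace_class f) (Lspace_class g) = Lspace_class (f + g).
Proof.
apply: Lspace_class_eq.
apply: filterS2 (Lspace_classP f) (Lspace_classP g) => x fx gx _.
exact: (congr2 +%R (fx I) (gx I)).
Qed.

Lemma Lspace_classN (f : ty) :
  Lspace_opp (Lspace_class f) = Lspace_class (- f).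
Proof.
apply: Lspace_class_eq.
apply: filterS (Lspace_classP f) => x fx _.
exact: (congr1 -%R (fx I)).
Qed.

Lemma Lspace_classZ a (f : ty) :
  Lspace_scale a (Lspace_class f) = Lspace_class (a *: f).
Proof.
apply: Lspace_class_eq.
apply: filterS (Lspace_classP f) => x fx _.
exact: (congr1 ( *%R a) (fx I)).
Qed.

Lemma Lspace_class_norm (f : ty) :
  Lspace_norm (Lspace_class f) = fine ('N[mu]_p[EFin \o f]%E).
Proof. by congr fine; apply: ae_eq_Lnorm => //; exact: Lspace_classP. Qed.

Fact Lspace_addA : associative Lspace_add.
Proof.
move=> u v w; rewrite -(Lspace_reprK u) -(Lspace_reprK v) -(Lspace_reprK w).
by rewrite !Lspace_classD addrA.
Qed.

Fact Lspace_addC : commutative Lspace_add.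
Proof.
move=> u v; rewrite -(Lspace_reprK u) -(Lspace_reprK v).
by rewrite !Lspace_classD addrC.
Qed.

Fact Lspace_add0 : left_id Lspace_zero Lspace_add.
Proof.
by move=> u; rewrite -(Lspace_reprK u) /Lspace_zero Lspace_classD add0r.
Qed.

Fact Lspace_addN : left_inverse Lspace_zero Lspace_opp Lspace_add.
Proof.
move=> u; rewrite -(Lspace_reprK u) Lspace_classN Lspace_classD.
by rewrite addNr.
Qed.

HB.instance Definition _ :=
  GRing.isZmodule.Build L Lspace_addA Lspace_addC Lspace_add0 Lspace_addN.

Lemma Lspace_class_add (f g : ty) :
  Lspace_class f + Lspace_class g = Lspace_class (f + g).
Proof. exact: Lspace_classD. Qed.

Fact Lspace_scaleA a b (u : L) :
  Lspace_scale a (Lspace_scale b u) = Lspace_scale (a * b) u.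
Proof. by rewrite -(Lspace_reprK u) !Lspace_classZ scalerA. Qed.

Fact Lspace_scale1 : left_id 1 Lspace_scale.
Proof. by move=> u; rewrite -(Lspace_reprK u) Lspace_classZ scale1r. Qed.

Fact Lspace_scaleDr : right_distributive Lspace_scale +%R.
Proof.
move=> a u v; rewrite -(Lspace_reprK u) -(Lspace_reprK v).
by rewrite Lspace_class_add !Lspace_classZ Lspace_class_add scalerDr.
Qed.

Fact Lspace_scaleDl (u : L) : {morph Lspace_scale^~ u : a b / a + b}.
Proof.
move=> a b; rewrite -(Lspace_reprK u) !Lspace_classZ.
by rewrite Lspace_class_add scalerDl.
Qed.

HB.instance Definition _ := GRing.Zmodule_isLmodule.Build R L
  Lspace_scaleA Lspace_scale1 Lspace_scaleDr Lspace_scaleDl.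

Lemma Lspace_class_scale a (f : ty) :
  a *: Lspace_class f = Lspace_class (a *: f).
Proof. exact: Lspace_classZ. Qed.

Fact Lspace_normD (u v : L) :
  Lspace_norm (u + v) <= Lspace_norm u + Lspace_norm v.
Proof.
rewrite -(Lspace_reprK u) -(Lspace_reprK v).
by rewrite Lspace_class_add !Lspace_class_norm; exact: ler_LnormD.
Qed.

Fact Lspace_normZ (a : R) (u : L) :
  Lspace_norm (a *: u) = `|a| * Lspace_norm u.
Proof.
rewrite -(Lspace_reprK u) Lspace_class_scale !Lspace_class_norm.
by rewrite LnormZ -finite_norm_fine.
Qed.

Fact Lspace_norm0_eq0 (u : L) : Lspace_norm u = 0 -> u = 0.
Proof.
move=> /fine_Lnormr_eq0 u0; rewrite -(Lspace_reprK u).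
exact: Lspace_class_eq.
Qed.

HB.instance Definition _ := Lmodule_isNormed.Build R L
  Lspace_normD Lspace_normZ Lspace_norm0_eq0.

Lemma Lspace_normE (f : ty) :
  `|Lspace_class f| = fine ('N[mu]_p[EFin \o f]%E).
Proof. exact: Lspace_class_norm. Qed.

End Lspace_normedModType.

(* Functions are defined on the whole line, but the measure ignores the
   complement of [0, 1]: up to a.e. equality, restriction to [0, 1] and
   extension by zero identify L_p of this measure with L_p[0, 1]. *)
Definition lebesgue01 (R : realType) :
    {measure set (measurableTypeR R) -> \bar R} :=
  mrestr lebesgue_measure (measurable_itv `[0 : R, 1]).

Definition Lp01 (R : realType) (p : R) (p1 : (1 <= p%:E)%E) : normedModType R :=
  LspaceType (lebesgue01 R) p1.

Section projection_constants.
Context (R : realType) (X : normedModType R).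

Definition linear_subspace (A : set X) : Prop := GRing.submod_closed (mem A).

Definition finite_dimensional (A : set X) : Prop :=
  exists (n : nat) (e : 'I_n -> X), (forall i, A (e i)) /\
    forall x, A x -> exists c : 'I_n -> R, x = \sum_(i < n) c i *: e i.

(* Only the values of [U] on [A] matter. *)
Definition linearly_isometric (A B : set X) : Prop :=
  exists U : X -> X,
    [/\ forall (a : R) (x y : X), A x -> A y -> U (a *: x + y) = a *: U x + U y,
        forall x, A x -> `|U x| = `|x|
      & U @` A = B].

Definition is_bounded_projection_onto (A : set X) (P : {linear X -> X}) : Prop :=
  [/\ bounded_near P (nbhs (0 : X)), forall x, P (P x) = P x & range P = A].

Definition operator_norm (P : {linear X -> X}) : R :=
  sup [set `|P x| | x in [set x : X | `|x| <= 1]].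

(* The value is +oo when [A] is not the range of any bounded projection. *)
Definition projection_constant (A : set X) : \bar R :=
  ereal_inf [set (operator_norm P)%:E | P in is_bounded_projection_onto A].

End projection_constants.

(* Main.v *)
(* Let [e_i] be a basis of A and [f_i] its image in B under the isometry, viewed
   as maps F, G : [0, 1] -> R^n. For every [r > 0] there is a linear contraction V
   of L_p with [|V f_i - e_i| <= r]. Given a projection P onto A, the operator
   [P V] maps B onto A almost like the inverse isometry, so that composing it with
   a matrix close to the identity yields a projection onto B whose norm is at most
   [|P| / (1 - h)] with h arbitrarily small; the situation is symmetric.

   For p = 2, V is the orthogonal projection onto B followed by the isometry.
   Otherwise p is not an even integer. The isometry says that the integrals of
   |<a, F>|^p and |<a, G>|^p agree for all a. Averaging over Gaussian vectors a
   gives the equality of the integrals of (y^T S y)^(p/2) at y = F and y = G for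
   all positive definite S, and differentiating with respect to S at S = I
   (the successive factors p/2 - m do not vanish) gives the equality for
   Q(y) |y|^(p - 2m), where Q is a product of m squares of linear forms.

   Some squares of linear forms add up to a multiple of |y|^2, so their quotients
   q_j by that multiple are a partition of unity; the products w_k of N such
   quotients form a finer one, which by the law of large numbers nearly determines
   the line spanned by y. The operator
     V u (x) = sum_k w_k(F x) / W_k * int w_k(G) |G|^(p-2) <F x, G> u,
   where W_k is the common integral of w_k(F) |F|^p and w_k(G) |G|^p, is a
   contraction by two applications of Jensen's inequality. Applied to G_i it only
   involves integrals that do not distinguish G from F, and it tends to F_i as N
   grows because w_k localizes the line spanned by F. *)
Require Import Defs.
From HB Require Import structures.
From mathcomp Require Import all_boot all_order all_algebra.
From mathcomp Require Import all_classical all_reals all_analysis.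
From mathcomp Require Import measurable_realfun ring lra.

Set Implicit Arguments.
Unset Strict Implicit.
Unset Printing Implicit Defensive.
Import Order.TTheory GRing.Theory Num.Theory.
Import numFieldNormedType.Exports.
Local Open Scope classical_set_scope.
Local Open Scope ring_scope.

(** * Estimates for real powers *)

Section powR_estimates.
Context (R : realType).
Implicit Types r x t s M : R.

Lemma powR1D_le r M x : 0 <= x <= M -> (1 + x) `^ r <= (1 + M) `^ `|r|.
Proof.
move=> /andP[x0 xM]; apply: (@le_trans _ _ ((1 + x) `^ `|r|)).
  by apply: ler_powR; [rewrite lerDl|exact: ler_norm].
by apply: ge0_ler_powR; rewrite ?normr_ge0 ?nnegrE ?addr_ge0 ?lerD2l// (le_trans x0).
Qed.

Let is_derive_1D (c : R) : is_derive c 1 (fun z : R => 1 + z) 1.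
Proof.
have := @is_deriveD R R^o R^o (cst 1) id c 1 0 1 _ _.
by rewrite add0r; apply.
Qed.

Lemma powR1D_MVT r x : 0 < x ->
  exists2 c, 0 < c < x & (1 + x) `^ r - 1 = r * (1 + c) `^ (r - 1) * x.
Proof.
move=> x0.
have df c : c \in `]0, x[ -> is_derive c 1 (fun z : R => (1 + z) `^ r)
    (r * (1 + c) `^ (r - 1)).
  rewrite in_itv/= => /andP[c0 _].
  have c1 : 0 < 1 + c by rewrite addr_gt0.
  have := @is_derive1_comp _ (fun z => z `^ r) (fun z : R => 1 + z) c _ _
    (is_derive1_powR r c1) (is_derive_1D c).
  by rewrite mulr1.
have cf : {within `[0, x], continuous (fun z : R => (1 + z) `^ r)}.
  apply: derivable_within_continuous => c; rewrite in_itv/= => /andP[c0 _].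
  have c1 : 0 < 1 + c by rewrite ltr_pwDl.
  by have [] := @is_derive1_comp _ (fun z => z `^ r) (fun z : R => 1 + z) c _ _
    (is_derive1_powR r c1) (is_derive_1D c).
have [c] := MVT x0 df cf.
by rewrite in_itv/= addr0 powR1 subr0 => cx ->; exists c.
Qed.

Lemma powR1D_lipschitz r M : 0 <= M -> exists2 C, 0 <= C &
  forall x, 0 <= x <= M -> `|(1 + x) `^ r - 1| <= C * x.
Proof.
move=> M0; exists (`|r| * (1 + M) `^ `|r - 1|); first by rewrite mulr_ge0 ?powR_ge0.
move=> x /andP[]; rewrite le_eqVlt => /predU1P[<- _|x0 xM].
  by rewrite addr0 powR1 subrr normr0 mulr0.
have [c /andP[c0 cx] ->] := powR1D_MVT r x0.
rewrite !normrM (gtr0_norm x0) ler_wpM2r ?(ltW x0)// ler_wpM2l//.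
by rewrite ger0_norm ?powR_ge0// powR1D_le// (ltW c0) (le_trans (ltW cx)).
Qed.

(** By the mean value theorem the increment is r x (1 + c)^(r - 1) with 0 < c < x, and the Lipschitz
    estimate for the exponent r - 1 compares the last factor with 1. *)
Lemma powR1D_taylor r M : 0 <= M -> exists2 C, 0 <= C &
  forall x, 0 <= x <= M -> `|(1 + x) `^ r - 1 - r * x| <= C * x ^+ 2.
Proof.
move=> M0; have [C C0 HC] := powR1D_lipschitz (r - 1) M0.
exists (`|r| * C); first by rewrite mulr_ge0.
move=> x /andP[]; rewrite le_eqVlt => /predU1P[<- _|x0 xM].
  by rewrite addr0 powR1 subrr sub0r mulr0 normrN normr0 expr0n mulr0.
have [c /andP[c0 cx] ->] := powR1D_MVT r x0.
rewrite -[X in X - _]mulrA -mulrBr -[X in _ - X]mul1r -mulrBl !normrM.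
rewrite (gtr0_norm x0) expr2 !mulrA ler_wpM2r ?(ltW x0)//.
rewrite -mulrA ler_wpM2l//; apply: le_trans (HC c _) _.
  by rewrite (ltW c0) (le_trans (ltW cx)).
by rewrite ler_wpM2l// ltW.
Qed.

(** Convexity of t^p, obtained from Young's inequality for t and s^(p - 1) with the conjugate
    exponents p and p / (p - 1). For p = 1 both sides agree. *)
Lemma powR_tangent (p t s : R) : 1 <= p -> 0 <= t -> 0 <= s ->
  s `^ p + p * s `^ (p - 1) * (t - s) <= t `^ p.
Proof.
move=> p1 t0 s0; have p0 : 0 < p by apply: lt_le_trans p1.
have spE : s `^ (p - 1) * s = s `^ p by rewrite mulrC mulr_powRB1.
move: p1; rewrite le_eqVlt => /predU1P[<-|p1].
  by rewrite subrr powRr0 !powRr1// !mul1r addrC subrK.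
have q0 : 0 < p / (p - 1) by rewrite divr_gt0 ?subr_gt0.
have pq : p^-1 + (p / (p - 1))^-1 = 1.
  by field; rewrite !gt_eqF ?subr_gt0.
have := conjugate_powR t0 (powR_ge0 s (p - 1)) p0 q0 pq.
rewrite -powRrM mulrCA divff ?subr_eq0 ?gt_eqF// mulr1 => /(ler_wpM2l (ltW p0)).
rewrite -spE => H; rewrite -subr_ge0 in H; rewrite -subr_ge0.
apply: le_trans H _; rewrite le_eqVlt; apply/orP; left; apply/eqP.
by field; rewrite !gt_eqF ?subr_gt0.
Qed.

End powR_estimates.

(** * Gaussian averages *)

Section gaussian.
Context (R : realType).
Local Notation leb := (@lebesgue_measure R).
Local Notation g := (@gauss_fun R).

Lemma continuous_affine (a b : R) : continuous (fun x : R => a * x + b).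
Proof.
move=> x; apply: (@cvgD _ R^o); last exact: cvg_cst.
by apply: cvgM; [exact: cvg_cst|exact: cvg_id].
Qed.

Lemma ge0_integral_affine (a b : R) (G : R -> R) : 0 < a ->
  continuous G -> (forall x, 0 <= G x) ->
  (\int[leb]_x (G x)%:E = a%:E * \int[leb]_x (G (a * x + b))%:E)%E.
Proof.
move=> a0 cG G0; pose F (x : R^o) : R^o := (x + a^-1 * b) * a.
have F'E : F^`()%classic = cst a.
  apply/funext => x; rewrite /F derive1E deriveM// deriveD// derive_cst scaler0.
  by rewrite add0r derive_id derive_cst addr0 scaler1.
have FE x : F x = a * x + b.
  by rewrite /F mulrDl mulrAC mulVf ?gt_eqF// mul1r mulrC.
have cGF : continuous (G \o F).
  rewrite (funext FE) => x; apply: continuous_comp; last exact: cG.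
  exact: continuous_affine.
rewrite (@increasing_ge0_integration_by_substitutionT _ F)//.
- rewrite -ge0_integralZl_EFin//; last 3 first.
  + by move=> x _; rewrite lee_fin.
  + apply/measurable_EFinP; rewrite (_ : (fun x => _) = G \o F).
      exact: (continuous_measurable_fun cGF).
    by apply/funext => x /=; rewrite FE.
  + exact: ltW.
  by apply: eq_integral => x _; rewrite -EFinM F'E /= -FE mulrC.
- by move=> x y xy; rewrite !FE ltrD2r ltr_pM2l.
- by rewrite F'E => ?; exact: cvg_cst.
- by rewrite F'E; exact: is_cvg_cst.
- by rewrite F'E; exact: is_cvg_cst.
- by apply/gt0_cvgMlNy => //; exact: cvg_addrr_Ny.
- by apply/gt0_cvgMly => //; exact: cvg_addrr.
Qed.

Lemma ge0_integral_oppr (G : R -> \bar R) : measurable_fun setT G ->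
  (forall x, 0 <= G x)%E ->
  (\int[leb]_x G x = \int[leb]_x G (- x)%R)%E.
Proof.
move=> mG G0.
rewrite [RHS](_ : _ = \int[leb]_(x in (-%R : R -> measurableTypeR R) @^-1` setT)
  (G \o (-%R : R -> measurableTypeR R)) x)%E//.
rewrite -ge0_integral_pushforward//=.
by apply: eq_measure_integral => //= A mA _; rewrite -lebesgue_measureN.
Qed.

(** Variances of independent centred Gaussians add up. The proof substitutes x = s h + u k in the
    inner integral, exchanges the integrals and completes the square in k. *)
Lemma gauss_convolution (f : R -> R) (s u : R) : 0 < s -> 
  continuous f -> (forall x, 0 <= f x) ->
  (\int[leb]_k \int[leb]_h (f (s * h + u * k) * g h * g k)%:E =
   (Num.sqrt pi)%:E * \int[leb]_m (f (Num.sqrt (s ^+ 2 + u ^+ 2) * m) * g m)%:E)%E.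
Proof.
move=> s0 cf f0.
have cg := @continuous_gauss_fun R.
have g0 := @gauss_fun_ge0 R.
pose t2 := s ^+ 2 + u ^+ 2; pose t := Num.sqrt t2.
have t20 : 0 < t2 by rewrite ltr_pwDl ?sqr_ge0 ?exprn_gt0.
have t0 : 0 < t by rewrite sqrtr_gt0.
have tE : t ^+ 2 = t2 by rewrite sqr_sqrtr// ltW.
rewrite -/t2 -/t.
have step1 k : (\int[leb]_h (f (s * h + u * k) * g h * g k)%:E =
    s^-1%:E * \int[leb]_x (f x * g (s^-1 * x + - (u / s * k)) * g k)%:E)%E.
  rewrite (@ge0_integral_affine s (u * k) (fun x => f x * g (s^-1 * x + - (u / s * k)) * g k))//.
  - rewrite muleA -EFinM mulVf ?gt_eqF// mul1e; apply: eq_integral => h _.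
    congr ((f _ * g _ * g k)%:E).
    by field; rewrite gt_eqF.
  - move=> x; apply: cvgM; last exact: cvg_cst.
    apply: cvgM; first exact: cf.
    by apply: continuous_comp; [exact: continuous_affine|exact: cg].
  - by move=> x; rewrite !mulr_ge0.
under eq_integral do rewrite step1.
have mg a b : measurable_fun setT (fun z : R * R => g (a * z.1 + b * z.2)).
  apply: (measurableT_comp (@measurable_gauss_fun R)).
  by apply: measurable_funD; apply: measurable_funM.
have mphi : measurable_fun setT (fun z : R * R =>
    (f z.2 * g (s^-1 * z.2 + - (u / s * z.1)) * g z.1)%:E).
  apply/measurable_EFinP; apply: measurable_funM.
    apply: measurable_funM.
      apply: measurableT_comp => //; exact: continuous_measurable_fun.
    rewrite (_ : (fun _ => _) =
      (fun z : R * R => g (- (u / s) * z.1 + s^-1 * z.2))); first exact: mg.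
    by apply/funext => z; rewrite addrC mulNr.
  exact: (measurableT_comp (@measurable_gauss_fun R)).
rewrite ge0_integralZl_EFin//; last 3 first.
- by move=> k _; apply: integral_ge0 => x _; rewrite lee_fin !mulr_ge0.
- apply: (measurable_fun_fubini_tonelli_F (m2 := leb) _ mphi) => z.
  by rewrite lee_fin !mulr_ge0.
- by rewrite invr_ge0 ltW//.
rewrite (@fubini_tonelli _ _ _ _ _ leb leb _ mphi); last first.
  by move=> z; rewrite lee_fin !mulr_ge0.
(* The square is completed as (x / t)^2 plus the square of an affine function of k with slope t / s,
   so that the integral over k is a full Gaussian integral. *)
have inner x : (\int[leb]_k (f x * g (s^-1 * x + - (u / s * k)) * g k)%:E =
    (f x * g (t^-1 * x) * (s / t * Num.sqrt pi))%:E)%E.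
  have st : 0 < t / s by rewrite divr_gt0.
  rewrite [in RHS]EFinM (_ : (s / t * Num.sqrt pi)%:E =
    \int[leb]_k (g (t / s * k + - (u * x / (s * t))))%:E)%E; last first.
    have := ge0_integral_affine (- (u * x / (s * t))) st cg g0.
    rewrite integralT_gauss => H; rewrite EFinM H.
    by rewrite muleA -EFinM -invf_div mulVf ?gt_eqF// mul1e.
  rewrite -ge0_integralZl_EFin//; last 3 first.
  - by move=> k _; rewrite lee_fin.
  - apply/measurable_EFinP; apply: (measurableT_comp (@measurable_gauss_fun R)).
    by apply: measurable_funD => //; exact: measurable_funM.
  - by rewrite mulr_ge0.
  apply: eq_integral => k _; rewrite -EFinM; congr EFin.
  rewrite -[LHS]mulrA -[RHS]mulrA; congr (f x * _).
  rewrite /gauss_fun -!expRD; congr expR.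
  rewrite -!opprD; congr (- _).
  have -> : (t^-1 * x) ^+ 2 = x ^+ 2 / t2 by rewrite exprMn exprVn tE mulrC.
  have -> : (t / s * k - u * x / (s * t)) ^+ 2 =
     t2 / s ^+ 2 * k ^+ 2 - (u * x * k * 2) / s ^+ 2 +
     u ^+ 2 * x ^+ 2 / (s ^+ 2 * t2).
    by rewrite -tE; field; rewrite !gt_eqF.
  have -> : x ^+ 2 / t2 = x ^+ 2 / s ^+ 2 - u ^+ 2 * x ^+ 2 / (s ^+ 2 * t2).
    have : t2 != 0 by rewrite gt_eqF.
    by rewrite /t2 => H; field; rewrite H gt_eqF.
  by move: (u ^+ 2 * _ / _) => Y; rewrite /t2; field; rewrite gt_eqF.
under eq_integral do rewrite inner.
have cG : continuous (fun x => f x * g (t^-1 * x + 0)).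
  move=> x; apply: cvgM; first exact: cf.
  by apply: continuous_comp; [exact: continuous_affine|exact: cg].
rewrite (_ : \int[leb]_m (f (t * m) * g m)%:E =
    t^-1%:E * \int[leb]_x (f x * g (t^-1 * x + 0))%:E)%E; last first.
  rewrite (@ge0_integral_affine t 0 _ t0 cG); last by move=> x; rewrite mulr_ge0.
  rewrite muleA -EFinM mulVf ?gt_eqF// mul1e; apply: eq_integral => m _.
  by rewrite !addr0 mulKf ?gt_eqF.
rewrite muleA -EFinM -ge0_integralZl_EFin//; last 3 first.
- by move=> x _; rewrite lee_fin !mulr_ge0// ?sqrtr_ge0 ?invr_ge0 ?ltW//.
- apply/measurable_EFinP; apply: measurable_funM => //.
  by under eq_fun do rewrite -[t^-1 * _]addr0; exact: (continuous_measurable_fun cG).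
- by rewrite invr_ge0 ltW//.
rewrite -ge0_integralZl_EFin//; last 3 first.
- by move=> x _; rewrite lee_fin mulr_ge0.
- by apply/measurable_EFinP; exact: (continuous_measurable_fun cG).
- by rewrite mulr_ge0 ?invr_ge0 ?(ltW t0) ?sqrtr_ge0.
apply: eq_integral => x _; rewrite -!EFinM addr0; congr EFin.
by field; rewrite !gt_eqF.
Qed.

End gaussian.

(* Up to the factor [sqrt pi], the p-th absolute moment of [c + sqrt s * Z] for a
   Gaussian Z: the weight [gauss_fun h = expR (- h ^+ 2)] is not normalized. *)
HB.lock Definition gauss_pow (R : realType) (p s c : R) : \bar R :=
  (\int[@lebesgue_measure R]_h
     (`|c + Num.sqrt s * h| `^ p * gauss_fun h)%:E)%E.

Section gaussian_average.
Context (R : realType).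
Local Notation leb := (@lebesgue_measure R).
Local Notation g := (@gauss_fun R).

Lemma integral_gaussZ (k : R) : 0 <= k ->
  (\int[leb]_h (k * g h)%:E = (Num.sqrt pi * k)%:E)%E.
Proof.
move=> k0; under eq_integral do rewrite EFinM.
rewrite ge0_integralZl_EFin//.
- by rewrite integralT_gauss -EFinM mulrC.
- by move=> x _; rewrite lee_fin gauss_fun_ge0.
- by apply/measurable_EFinP; exact: measurable_gauss_fun.
Qed.

(** Extends [gauss_convolution] to variance s = 0: the weight in h then integrates to sqrt pi, and
    evenness of the weight in k turns u into |u|. *)
Lemma gauss_average (f : R -> R) (s u : R) : 0 <= s ->
  continuous f -> (forall x, 0 <= f x) ->
  (\int[leb]_k \int[leb]_h (f (Num.sqrt s * h + u * k) * g h * g k)%:E =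
   (Num.sqrt pi)%:E * \int[leb]_m (f (Num.sqrt (s + u ^+ 2) * m) * g m)%:E)%E.
Proof.
move=> s0 cf f0.
have g0 := @gauss_fun_ge0 R.
move: s0; rewrite le_eqVlt => /predU1P[<-|s0]; last first.
  rewrite gauss_convolution ?sqrtr_gt0//.
  by rewrite sqr_sqrtr// ltW.
rewrite sqrtr0 add0r sqrtr_sqr.
have mf : measurable_fun setT f by exact: continuous_measurable_fun.
have mfg v : measurable_fun setT (fun k : R => f (v * k) * g k).
  apply: measurable_funM; last exact: measurable_gauss_fun.
  by apply: measurableT_comp => //; exact: measurable_funM.
transitivity ((Num.sqrt pi)%:E * \int[leb]_k (f (u * k) * g k)%:E)%E.
  transitivity (\int[leb]_k ((Num.sqrt pi)%:E * (f (u * k) * g k)%:E))%E.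
    apply: eq_integral => k _; rewrite -EFinM.
    apply: etrans (integral_gaussZ (mulr_ge0 (f0 _) (g0 k))).
    by apply: eq_integral => h _; rewrite mul0r add0r mulrAC.
  apply: ge0_integralZl_EFin => //.
  - by move=> x _; rewrite lee_fin mulr_ge0.
  - by apply/measurable_EFinP; exact: mfg.
congr (_ * _)%E; have [u0|u0] := leP 0 u; first by rewrite ger0_norm.
rewrite ltr0_norm//.
rewrite (@ge0_integral_oppr _ (fun k => (f (u * k) * g k)%:E)).
- by apply: eq_integral => k _; rewrite mulrN mulNr /gauss_fun sqrrN.
- by apply/measurable_EFinP; exact: mfg.
- by move=> k; rewrite lee_fin mulr_ge0.
Qed.

Lemma gauss_pow0 (p c : R) : gauss_pow p 0 c = ((Num.sqrt pi) * `|c| `^ p)%:E.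
Proof.
rewrite unlock; apply: etrans (integral_gaussZ (powR_ge0 _ _)).
by apply: eq_integral => h _; rewrite sqrtr0 mul0r addr0.
Qed.

Lemma gauss_pow_ge0 (p s c : R) : (0 <= gauss_pow p s c)%E.
Proof.
rewrite unlock.
by apply: integral_ge0 => h _; rewrite lee_fin mulr_ge0 ?powR_ge0 ?gauss_fun_ge0.
Qed.

Lemma continuous_normr_powR (p : R) : 1 <= p ->
  continuous (fun x : R => `|x| `^ p).
Proof.
move=> p1 x; have [->|x0] := eqVneq x 0; last first.
  apply: (@continuous_comp _ _ _ (fun y : R => `|y|) (fun y : R => y `^ p)).
    exact: norm_continuous.
  have x1 : 0 < `|x| by rewrite normr_gt0.
  have [/derivable1_diffP/differentiable_continuous //] := is_derive1_powR p x1.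
apply/cvgrPdist_lt => e e0; near=> y.
have p0 : p != 0 by rewrite gt_eqF// (lt_le_trans ltr01).
rewrite normr0 powR0// sub0r normrN ger0_norm ?powR_ge0//.
have [->|y0] := eqVneq y 0; first by rewrite normr0 powR0.
have y1 : `|y| <= 1.
  near: y; apply: (@filterS _ _ _ (fun y => `|0 - y| < 1)) => [y|].
    by rewrite sub0r normrN => /ltW.
  by exists 1 => //= y.
have ye : `|y| < e.
  near: y; apply: (@filterS _ _ _ (fun y => `|0 - y| < e)) => [y|].
    by rewrite sub0r normrN.
  by exists e => //= y.
apply: le_lt_trans ye; rewrite -[leRHS]powRr1//.
by apply: ger_powR; rewrite // normr_gt0 y0.
Unshelve. all: by end_near. Qed.

Lemma gauss_pow_center (p s : R) : 0 < p -> 0 <= s -> 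
  gauss_pow p s 0 = ((s `^ (p / 2))%:E * gauss_pow p 1 0)%E.
Proof.
move=> p0 s0; rewrite unlock -ge0_integralZl_EFin//; last 3 first.
- by move=> x _; rewrite lee_fin mulr_ge0 ?powR_ge0 ?gauss_fun_ge0.
- apply/measurable_EFinP/measurable_funM; last exact: measurable_gauss_fun.
  apply: (measurableT_comp (measurable_powR _)) => //.
  by apply: measurableT_comp => //; apply: measurable_funD.
- by rewrite powR_ge0.
apply: eq_integral => h _; rewrite -EFinM; congr EFin.
rewrite !add0r sqrtr1 mul1r normrM powRM ?normr_ge0// ger0_norm ?sqrtr_ge0//.
rewrite -powR12_sqrt// -powRrM mulrA; congr (_ `^ _ * _ * _).
by rewrite mulrC.
Qed.

Lemma mule_fin_inj (k : R) : 0 < k -> injective (fun x : \bar R => k%:E * x)%E.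
Proof.
move=> k0 x y /(congr1 (fun z => k^-1%:E * z)%E).
by rewrite !muleA -!EFinM mulVf ?gt_eqF// !mul1e.
Qed.

Context d (T : measurableType d) (mu : {sigma_finite_measure set T -> \bar R}).

(** The variable [z] is ((k, x), h): h is the Gaussian variable inside [gauss_pow], and k a second
    one that shifts the centre by u(x) k. *)
Let phi (p : R) (s c u : T -> R) (z : R * T * R) : R :=
  `|c z.1.2 + u z.1.2 * z.1.1 + Num.sqrt (s z.1.2) * z.2| `^ p * g z.2 * g z.1.1.

Let measurable_phi (p : R) (s c u : T -> R) : measurable_fun setT s ->
  measurable_fun setT c -> measurable_fun setT u ->
  measurable_fun setT (phi p s c u).
Proof.
move=> ms mc mu_.
have mx : measurable_fun setT (fun z : R * T * R => z.1.2).
  exact: (measurableT_comp (@measurable_snd _ _ _ _) (@measurable_fst _ _ _ _)).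
have mk : measurable_fun setT (fun z : R * T * R => z.1.1).
  exact: (measurableT_comp (@measurable_fst _ _ _ _) (@measurable_fst _ _ _ _)).
have mg (h : R * T * R -> R) : measurable_fun setT h ->
    measurable_fun setT (fun z => g (h z)).
  exact: (measurableT_comp (@measurable_gauss_fun R)).
apply: measurable_funM; last exact: mg.
apply: measurable_funM; last exact: mg.
apply: (measurableT_comp (measurable_powR _)) => //.
apply: measurableT_comp => //; apply: measurable_funD.
  apply: measurable_funD; first exact: (measurableT_comp mc).
  by apply: measurable_funM => //; exact: (measurableT_comp mu_).
apply: measurable_funM => //.
apply: (measurableT_comp (continuous_measurable_fun (@sqrt_continuous R))).
exact: (measurableT_comp ms).
Qed.

Let phi_ge0 p s c u z : 0 <= phi p s c u z.
Proof. by rewrite !mulr_ge0 ?powR_ge0 ?gauss_fun_ge0. Qed.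

Let phiE (p : R) (s c u : T -> R) k x : 
  (\int[leb]_h (phi p s c u (k, x, h))%:E =
    (g k)%:E * gauss_pow p (s x) (c x + u x * k))%E.
Proof.
rewrite unlock.
rewrite -ge0_integralZl_EFin//; last 3 first.
- by move=> h _; rewrite lee_fin mulr_ge0 ?powR_ge0 ?gauss_fun_ge0.
- apply/measurable_EFinP/measurable_funM; last exact: measurable_gauss_fun.
  apply: (measurableT_comp (measurable_powR _)) => //.
  by apply: measurableT_comp => //; apply: measurable_funD.
- exact: gauss_fun_ge0.
by apply: eq_integral => h _; rewrite -EFinM /phi /= mulrC.
Qed.

(** Tonelli makes the partial integral of [phi] in h measurable; the slice k = 0, where the weight
    of k is 1, is [gauss_pow]. *)
Lemma measurable_gauss_pow (p : R) (s c : T -> R) : measurable_fun setT s ->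
  measurable_fun setT c -> measurable_fun setT (fun x => gauss_pow p (s x) (c x)).
Proof.
move=> ms mc.
have mphi : measurable_fun setT (EFin \o phi p s c (cst 0)).
  by apply/measurable_EFinP; exact: measurable_phi.
have mI := measurable_fun_fubini_tonelli_F (m2 := leb) _ mphi
  (fun z => phi_ge0 p s c (cst 0) z).
apply: (eq_measurable_fun _ _ (measurableT_comp mI (measurable_pair1 (0 : R)))) => x _.
by rewrite /= /fubini_F phiE mul0r addr0 /gauss_fun expr0n oppr0 expR0 mul1e.
Qed.

(** Averaging over the Gaussian shift u(x) k of the centre adds u(x)^2 to the variance; Tonelli
    carries this through the integral over [mu]. *)
Lemma gauss_pow_average (p : R) (s c u : T -> R) : 1 <= p -> measurable_fun setT s ->
  measurable_fun setT c -> measurable_fun setT u -> (forall x, 0 <= s x) ->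
  (\int[leb]_k ((g k)%:E * \int[mu]_x gauss_pow p (s x) (c x + u x * k)) =
   (Num.sqrt pi)%:E * \int[mu]_x gauss_pow p (s x + u x ^+ 2) (c x))%E.
Proof.
move=> p1 ms mc mu_ s0.
have mphi : measurable_fun setT (EFin \o phi p s c u).
  by apply/measurable_EFinP; exact: measurable_phi.
have mI := measurable_fun_fubini_tonelli_F (m2 := leb) _ mphi 
  (fun z => phi_ge0 p s c u z).
transitivity (\int[leb]_k \int[mu]_x \int[leb]_h (phi p s c u (k, x, h))%:E)%E.
  apply: eq_integral => k _.
  under [RHS]eq_integral do rewrite phiE.
  rewrite [RHS]ge0_integralZl_EFin//.
  - by move=> x _; exact: gauss_pow_ge0.
  - apply: measurable_gauss_pow => //; apply: measurable_funD => //.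
    exact: measurable_funM.
  - exact: gauss_fun_ge0.
rewrite (@fubini_tonelli _ _ _ _ _ leb mu _ mI); last first.
  by move=> z; apply: integral_ge0 => h _; rewrite lee_fin.
transitivity (\int[mu]_x ((Num.sqrt pi)%:E *
    gauss_pow p (s x + u x ^+ 2) (c x)))%E; last first.
  apply: ge0_integralZl_EFin => //.
    by move=> x _; exact: gauss_pow_ge0.
  apply: measurable_gauss_pow => //; apply: measurable_funD => //.
  exact: measurable_funX.
apply: eq_integral => x _; rewrite unlock.
have cf : continuous (fun y : R => `|c x + y| `^ p).
  move=> y; apply: (@continuous_comp _ _ _ (fun y : R => c x + y)
    (fun y : R => `|y| `^ p)); last exact: continuous_normr_powR.
  by apply: (@cvgD _ R^o); [exact: cvg_cst|exact: cvg_id].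
apply: etrans (gauss_average (u x) (s0 x) cf (fun y => powR_ge0 _ _)).
apply: eq_integral => k _; apply: eq_integral => h _.
by rewrite /= /phi/= addrAC -addrA.
Qed.

(** Induction on [bs]: the equality at the centres a + k b, averaged over a Gaussian k, puts b into
    the list. Hence the quantification over all centres [a]. *)
Lemma gauss_pow_list (p : R) n (F G : 'I_n -> T -> R) : 1 <= p ->
  (forall i, measurable_fun setT (F i)) -> (forall i, measurable_fun setT (G i)) ->
  (forall a : 'I_n -> R, \int[mu]_x (`|\sum_i a i * F i x| `^ p)%:E =
    \int[mu]_x (`|\sum_i a i * G i x| `^ p)%:E)%E ->
  forall (bs : seq ('I_n -> R)) (a : 'I_n -> R), 
  (\int[mu]_x gauss_pow p (\sum_(b <- bs) (\sum_i b i * F i x) ^+ 2)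
    (\sum_i a i * F i x) =
   \int[mu]_x gauss_pow p (\sum_(b <- bs) (\sum_i b i * G i x) ^+ 2)
    (\sum_i a i * G i x))%E.
Proof.
move=> p1 mF mG FG.
have mdot (H : 'I_n -> T -> R) (b : 'I_n -> R) :
    (forall i, measurable_fun setT (H i)) ->
    measurable_fun setT (fun x => \sum_i b i * H i x).
  by move=> mH; apply: measurable_sum => i; exact: measurable_funM.
elim=> [|b bs IH] a.
  under eq_integral do rewrite big_nil gauss_pow0 EFinM.
  under [RHS]eq_integral do rewrite big_nil gauss_pow0 EFinM.
  have mp (H : 'I_n -> T -> R) : (forall i, measurable_fun setT (H i)) ->
      measurable_fun setT (fun x => (`|\sum_i a i * H i x| `^ p)%:E).
    move=> mH; apply/measurable_EFinP.
    apply: (measurableT_comp (measurable_powR _)) => //.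
    by apply: measurableT_comp => //; exact: mdot.
  rewrite !ge0_integralZl_EFin ?FG//; try exact: mp;
    by move=> x _; rewrite lee_fin powR_ge0.
have key (H : 'I_n -> T -> R) : (forall i, measurable_fun setT (H i)) ->
  (\int[leb]_k ((g k)%:E * \int[mu]_x
      gauss_pow p (\sum_(b <- bs) (\sum_i b i * H i x) ^+ 2)
       (\sum_i (a i + b i * k) * H i x)) =
   (Num.sqrt pi)%:E * \int[mu]_x
      gauss_pow p (\sum_(b <- b :: bs) (\sum_i b i * H i x) ^+ 2)
       (\sum_i a i * H i x))%E.
  move=> mH.
  under [in RHS]eq_integral do rewrite big_cons addrC.
  have ms : measurable_fun setT
      (fun x => \sum_(b <- bs) (\sum_i b i * H i x) ^+ 2).
    by apply: measurable_sum => c; apply: measurable_funX; exact: mdot.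
  have s0 x : 0 <= \sum_(b <- bs) (\sum_i b i * H i x) ^+ 2.
    by apply: sumr_ge0 => c _; exact: sqr_ge0.
  apply: etrans (gauss_pow_average p1 ms (mdot H a mH) (mdot H b mH) s0).
  apply: eq_integral => k _; congr (_ * _)%E; apply: eq_integral => x _.
  congr gauss_pow; rewrite mulr_suml -big_split/=; apply: eq_bigr => i _.
  by rewrite mulrDl mulrAC.
apply: (@mule_fin_inj (Num.sqrt pi)); first by rewrite sqrtr_gt0 pi_gt0.
rewrite -(key F mF) -(key G mG).
apply: eq_integral => k _; congr (_ * _)%E; exact: IH.
Qed.

End gaussian_average.

(** * Finiteness and positivity of the Gaussian moments *)

Section gauss_moment.
Context (R : realType).
Local Notation leb := (@lebesgue_measure R).
Local Notation g := (@gauss_fun R).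

Lemma gauss_pow1_lty (p : R) : 0 <= p -> (gauss_pow p 1 0 < +oo)%E.
Proof.
move=> p0; rewrite unlock.
(* With an integer m above p and this C, |h|^p is at most C exp(h^2 / 2), so the integrand is at
   most C times a wider Gaussian. *)
pose m := (Num.trunc p).+1.
have m0 : 0 < m%:R *+ 2 :> R by rewrite pmulrn_lgt0.
have pm : p <= m%:R by apply: ltW; exact: truncnS_gt.
pose C := (m%:R *+ 2) ^+ m * 2 ^+ m : R.
have C0 : 0 <= C by rewrite mulr_ge0 ?exprn_ge0// ltW.
have bnd h : `|0 + Num.sqrt 1 * h| `^ p * g h <= C * g (Num.sqrt 2^-1 * h + 0).
  rewrite add0r sqrtr1 mul1r addr0.
  have -> : g (Num.sqrt 2^-1 * h) = expR (h ^+ 2 / 2) * g h.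
    rewrite /gauss_fun -expRD exprMn sqr_sqrtr; last by rewrite invr_ge0.
    by congr expR; field.
  rewrite mulrA ler_wpM2r ?gauss_fun_ge0//.
  have h1 : `|h| `^ p <= (1 + h ^+ 2) ^+ m * 2 ^+ m.
    have le1 : `|h| <= (1 + h ^+ 2) * 2.
      by rewrite ler_norml; apply/andP; split; nra.
    have ge1 : 1 <= (1 + h ^+ 2) * 2 by nra.
    apply: (@le_trans _ _ (((1 + h ^+ 2) * 2) `^ p)).
      by apply: ge0_ler_powR => //; rewrite nnegrE; exact: (le_trans ler01 ge1).
    rewrite -exprMn -(@powR_mulrn _ ((1 + h ^+ 2) * 2)) ?(le_trans ler01 ge1)//.
    exact: ler_powR.
  apply: (le_trans h1).
  rewrite /C mulrAC ler_wpM2r ?exprn_ge0//.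
  have h2 : (1 + h ^+ 2) <= (m%:R *+ 2) * (1 + h ^+ 2 / (m%:R *+ 2)).
    rewrite mulrDr mulr1 mulrCA divff ?gt_eqF// mulr1 lerD2r.
    by rewrite -mulr_natr -natrM ler1n muln_gt0.
  (* The inequality 1 + x <= exp x at x = h^2 / (2 m), raised to the power m. *)
  have h3 : (1 + h ^+ 2 / (m%:R *+ 2)) ^+ m <= expR (h ^+ 2 / 2).
    have -> : h ^+ 2 / 2 = (h ^+ 2 / (m%:R *+ 2)) * m%:R.
      rewrite -mulr_natr; field.
      by rewrite pnatr_eq0.
    rewrite expRM_natr; apply: lerXn2r; rewrite ?nnegrE ?expR_ge0 ?expR_ge1Dx//.
    by rewrite addr_ge0// divr_ge0 ?sqr_ge0// ltW.
  apply: (@le_trans _ _ (((m%:R *+ 2) * (1 + h ^+ 2 / (m%:R *+ 2))) ^+ m)).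
    apply: lerXn2r => //; rewrite nnegrE.
      by rewrite addr_ge0 ?sqr_ge0.
    by rewrite mulr_ge0 ?(ltW m0)// addr_ge0// divr_ge0 ?sqr_ge0// ltW.
  by rewrite exprMn ler_wpM2l ?exprn_ge0// ltW.
have q0 : 0 < Num.sqrt (2^-1 : R) by rewrite sqrtr_gt0 invr_gt0.
have cg : continuous (fun x => g (Num.sqrt 2^-1 * x + 0)).
  by move=> x; apply: continuous_comp; [exact: continuous_affine|exact: continuous_gauss_fun].
apply: (@le_lt_trans _ _ (\int[leb]_h (C * g (Num.sqrt 2^-1 * h + 0))%:E)%E).
  apply: ge0_le_integral => //.
  - by move=> x _; rewrite lee_fin mulr_ge0 ?powR_ge0 ?gauss_fun_ge0.
  - apply/measurable_EFinP/measurable_funM; last exact: measurable_gauss_fun.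
    apply: (measurableT_comp (measurable_powR _)) => //.
    by apply: measurableT_comp => //; apply: measurable_funD.
  - by apply/measurable_EFinP/measurable_funM => //; exact: (continuous_measurable_fun cg).
  by move=> x _; rewrite lee_fin; exact: bnd.
under eq_integral do rewrite EFinM.
rewrite ge0_integralZl_EFin//; last 2 first.
- by move=> x _; rewrite lee_fin gauss_fun_ge0.
- by apply/measurable_EFinP; exact: (continuous_measurable_fun cg).
have := ge0_integral_affine 0 q0 (@continuous_gauss_fun R) (@gauss_fun_ge0 R).
move=> /(congr1 (fun z => (Num.sqrt 2^-1)^-1%:E * z)%E).
rewrite muleA -EFinM mulVf ?gt_eqF// mul1e => <-.
by rewrite integralT_gauss -!EFinM ltry.
Qed.

Lemma gauss_pow1_gt0 (p : R) : (0 < gauss_pow p 1 0)%E.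
Proof.
rewrite unlock.
have mf : measurable_fun setT
    (fun h : R => (`|0 + Num.sqrt 1 * h| `^ p * g h)%:E).
  apply/measurable_EFinP/measurable_funM; last exact: measurable_gauss_fun.
  apply: (measurableT_comp (measurable_powR _)) => //.
  by apply: measurableT_comp => //; apply: measurable_funD.
rewrite lt_neqAle integral_ge0 ?andbT; last first.
  by move=> x _; rewrite lee_fin mulr_ge0 ?powR_ge0 ?gauss_fun_ge0.
apply/eqP => /esym/eqP K0.
have /(ae_eq_integral_abs leb measurableT mf)[N [mN N0 sub]] :
    (\int[leb]_h `|(`|0 + Num.sqrt 1 * h| `^ p * g h)%:E| = 0)%E.
  rewrite -(eqP K0); apply: eq_integral => h _.
  by rewrite gee0_abs// lee_fin mulr_ge0 ?powR_ge0 ?gauss_fun_ge0.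
(* A zero integral would make the integrand vanish almost everywhere, but it is positive on [1, 2],
   which has measure 1. *)
have : (leb `[1%R, 2%R]%classic <= leb N)%E.
  apply: le_measure; rewrite ?inE//.
  move=> h /=; rewrite in_itv/= => /andP[h1 _]; apply: sub => /= /(_ I)/eqP.
  rewrite eqe add0r sqrtr1 mul1r; apply/negP.
  rewrite gt_eqF// mulr_gt0 ?expR_gt0//; apply: powR_gt0.
  by rewrite normr_gt0 gt_eqF// (lt_le_trans ltr01).
by rewrite N0 lebesgue_measure_itv/= lte_fin ltr1n -EFinD lee_fin; lra.
Qed.

End gauss_moment.

(** * Integrals of homogeneous functions *)

Section forms.
Context (R : realType) (n : nat).
Implicit Types (a b y : 'I_n -> R) (bs : seq ('I_n -> R)).

Definition dot a y := \sum_i a i * y i.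
Definition nsq y := \sum_i y i ^+ 2.
Definition quad bs y := \sum_(b <- bs) dot b y ^+ 2.

Lemma nsq_ge0 y : 0 <= nsq y.
Proof. by apply: sumr_ge0 => i _; exact: sqr_ge0. Qed.

Lemma quad_ge0 bs y : 0 <= quad bs y.
Proof. by apply: sumr_ge0 => b _; exact: sqr_ge0. Qed.

Lemma nsq_eq0 y i : nsq y = 0 -> y i = 0.
Proof.
move/eqP; rewrite psumr_eq0; last by move=> j _; exact: sqr_ge0.
by move=> /allP/(_ i (mem_index_enum i)) /=; rewrite sqrf_eq0 => /eqP.
Qed.

(** Cauchy-Schwarz, from the nonnegativity of the squared length of |a|^2 y - <a, y> a. *)
Lemma dot_sqr_le a y : dot a y ^+ 2 <= nsq a * nsq y.
Proof.
have [a0|a0] := eqVneq (nsq a) 0.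
  rewrite a0 mul0r /dot big1 ?expr0n// => i _.
  by rewrite (nsq_eq0 i a0) mul0r.
have : 0 <= nsq (fun i => nsq a * y i - dot a y * a i) by exact: nsq_ge0.
rewrite [nsq (fun _ => _)](_ : _ = nsq a * (nsq a * nsq y - dot a y ^+ 2)).
  by rewrite pmulr_rge0 ?subr_ge0// lt_neqAle eq_sym a0 nsq_ge0.
rewrite {1}/nsq.
transitivity (\sum_i (nsq a ^+ 2 * y i ^+ 2 - nsq a * dot a y *+ 2 * (a i * y i)
    + dot a y ^+ 2 * a i ^+ 2)).
  by apply: eq_bigr => i _; ring.
rewrite big_split sumrB/= -!mulr_sumr -/(nsq y) -/(nsq a) -/(dot a y).
ring.
Qed.

Lemma quad_le bs y : quad bs y <= (\sum_(b <- bs) nsq b) * nsq y.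
Proof. by rewrite mulr_suml ler_sum// => b _; exact: dot_sqr_le. Qed.

Definition delta i : 'I_n -> R := fun j => (j == i)%:R.

Lemma dot_delta i y : dot (delta i) y = y i.
Proof.
rewrite /dot (bigD1 i)//= /delta eqxx mul1r big1 ?addr0// => j ji.
by rewrite (negbTE ji) mul0r.
Qed.

Lemma nsqE y : nsq y = quad [seq delta i | i <- enum 'I_n] y.
Proof.
rewrite /quad big_map big_enum/=.
by apply: eq_bigr => i _; rewrite dot_delta.
Qed.

Lemma quad_cat bs cs y : quad (bs ++ cs) y = quad bs y + quad cs y.
Proof. by rewrite /quad big_cat. Qed.

Lemma quad_cons b bs y : quad (b :: bs) y = dot b y ^+ 2 + quad bs y.
Proof. by rewrite /quad big_cons. Qed.

Lemma dotZ (t : R) a y : dot (fun i => t * a i) y = t * dot a y.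
Proof. by rewrite /dot mulr_sumr; apply: eq_bigr => i _; rewrite mulrA. Qed.

(** |y|^2 is at most n times the square of the largest coordinate. *)
Lemma nsq_powR_le (p : R) y : 0 < p ->
  nsq y `^ (p / 2) <= n%:R `^ (p / 2) * \sum_i `|y i| `^ p.
Proof.
move=> p0; have p20 : 0 <= p / 2 by rewrite divr_ge0 ?ltW.
have S0 (P : pred 'I_n) : 0 <= \sum_(i | P i) `|y i| `^ p.
  by apply: sumr_ge0 => i _; exact: powR_ge0.
have [y0|] := eqVneq (nsq y) 0.
  rewrite y0 powR0 ?mulr_ge0 ?powR_ge0//; last by rewrite mulf_neq0 ?gt_eqF.
case: (pickP 'I_n) => [i0 _ y0|no]; last first.
  by rewrite /nsq big1 ?eqxx// => i; have := no i.
case: (@arg_maxP _ _ _ i0 xpredT (fun i => y i ^+ 2)) => // i _ Hi.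
have H : nsq y <= n%:R * `|y i| ^+ 2.
  rewrite real_normK ?num_real//.
  apply: (@le_trans _ _ (\sum_(j < n) y i ^+ 2)).
    by apply: ler_sum => j _; exact: Hi.
  by rewrite sumr_const card_ord mulr_natl.
apply: (@le_trans _ _ ((n%:R * `|y i| ^+ 2) `^ (p / 2))).
  by apply: ge0_ler_powR => //; rewrite nnegrE ?nsq_ge0// mulr_ge0 ?sqr_ge0.
rewrite powRM ?sqr_ge0// -powR_mulrn// -powRrM [2 * _]mulrC divfK ?gt_eqF//.
by rewrite ler_wpM2l ?powR_ge0// (bigD1 i)//= lerDl.
Qed.
End forms.

(* The Fubini-Tonelli theorem needs a canonical sigma-finite structure, whereas
   [lebesgue01] is only declared as a measure. *)
Section sigma_finite_copy.
Context d (T : measurableType d) (R : realType).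
Variable mu : {measure set T -> \bar R}.

Definition sigma_finite_copy (sf : sigma_finite setT mu) : set T -> \bar R := mu.

Variable sf : sigma_finite setT mu.
HB.instance Definition _ := Measure.copy (sigma_finite_copy sf) mu.
HB.instance Definition _ :=
  @Measure_isSigmaFinite.Build _ _ _ (sigma_finite_copy sf) sf.

End sigma_finite_copy.

(** * Functions growing at most like |y|^p *)

Section dominated.
Context d (T : measurableType d) (R : realType).
Variables (mu : {measure set T -> \bar R}) (n : nat) (p : R).
Hypothesis p0 : 0 < p.
Implicit Types (c h k : ('I_n -> R) -> R) (H : 'I_n -> T -> R).

Definition Lp_family H := (forall i, measurable_fun setT (H i)) /\
  forall i, (\int[mu]_x (`|H i x| `^ p)%:E < +oo)%E.

(** The bound makes the composite with any [Lp_family] integrable. Stating measurability along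
    measurable families avoids choosing a sigma-algebra on the domain of [h]. *)
Definition dominated h :=
  (exists C, forall y, `|h y| <= C * nsq y `^ (p / 2)) /\
  (forall H, (forall i, measurable_fun setT (H i)) ->
    measurable_fun setT (fun x => h (H^~ x))).

Lemma dominated_nsq : dominated (fun y => nsq y `^ (p / 2)).
Proof.
split; first by exists 1 => y; rewrite mul1r ger0_norm ?powR_ge0.
move=> H mH; apply: (measurableT_comp (measurable_powR _)) => //.
by apply: measurable_sum => i; exact: measurable_funX.
Qed.

Lemma dominated_integrable H h : Lp_family H -> dominated h ->
  mu.-integrable setT (fun x => (h (H^~ x))%:E).
Proof.
move=> [mH lH] [[C hC] mh].
have iH i : mu.-integrable setT (fun x => (`|H i x| `^ p)%:E).
  apply/integrableP; split.
    apply/measurable_EFinP; apply: (measurableT_comp (measurable_powR _)) => //.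
    exact: measurableT_comp.
  under eq_integral do rewrite gee0_abs ?lee_fin ?powR_ge0//.
  exact: lH.
pose D := `|C| * n%:R `^ (p / 2).
have iS : mu.-integrable setT (fun x => (D%:E * \sum_i (`|H i x| `^ p)%:E)%E).
  by apply: integrableZl => //; apply: integrable_sum.
apply: (le_integrable measurableT _ _ iS).
  by apply/measurable_EFinP; exact: mh.
move=> x _; rewrite sumEFin -EFinM /= lee_fin.
have S0 : 0 <= \sum_i `|H i x| `^ p by apply: sumr_ge0 => i _; exact: powR_ge0.
rewrite [leRHS]ger0_norm; last by rewrite !mulr_ge0 ?powR_ge0.
apply: (le_trans (hC _)).
apply: (@le_trans _ _ (`|C| * nsq (H^~ x) `^ (p / 2))).
  by rewrite ler_wpM2r ?powR_ge0 ?ler_norm.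
by rewrite /D -mulrA ler_wpM2l// nsq_powR_le.
Qed.

Lemma dominatedD h k : dominated h -> dominated k -> dominated (fun y => h y + k y).
Proof.
move=> [[C hC] mh] [[D kD] mk]; split.
  exists (C + D) => y; rewrite mulrDl (le_trans (ler_normD _ _))//.
  by rewrite lerD.
by move=> H mH; apply: measurable_funD; [exact: mh|exact: mk].
Qed.

Lemma dominatedM c h : (forall y, `|c y| <= 1) -> 
  (forall H, (forall i, measurable_fun setT (H i)) ->
    measurable_fun setT (fun x => c (H^~ x))) ->
  dominated h -> dominated (fun y => c y * h y).
Proof.
move=> c1 mc [[C hC] mh]; split.
  exists C => y; rewrite normrM; apply: le_trans (hC y).
  by rewrite ler_piMl.
by move=> H mH; apply: measurable_funM; [exact: mc|exact: mh].
Qed.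

Lemma dominatedZ (c : R) h : dominated h -> dominated (fun y => c * h y).
Proof.
move=> [[C hC] mh]; split.
  by exists (`|c| * C) => y; rewrite normrM -mulrA ler_wpM2l.
by move=> H mH; apply: measurable_funM => //; exact: mh.
Qed.

End dominated.

(** * Integrals of powers of quadratic forms *)

Section moments.
Context d (T : measurableType d) (R : realType).
Variables (mu : {measure set T -> \bar R}) (n : nat) (p : R).
Variables F G : 'I_n -> T -> R.
Hypothesis sf : sigma_finite setT mu.
Hypothesis p1 : 1 <= p.
Hypothesis pN : forall m : nat, p / 2 != m%:R.
Hypothesis LF : Lp_family mu p F.
Hypothesis LG : Lp_family mu p G.
Hypothesis FG : forall a : 'I_n -> R,
  (\int[mu]_x (`|dot a (F^~ x)| `^ p)%:E = \int[mu]_x (`|dot a (G^~ x)| `^ p)%:E)%E.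

Let p0 : 0 < p. Proof. exact: lt_le_trans p1. Qed.

(** At centre 0, [gauss_pow] is the variance to the power p / 2 times a Gaussian moment; this moment
    is positive and finite, hence cancels. *)
Lemma quad_integral_eq bs :
  (\int[mu]_x (quad bs (F^~ x) `^ (p / 2))%:E =
   \int[mu]_x (quad bs (G^~ x) `^ (p / 2))%:E)%E.
Proof.
have := @gauss_pow_list R d T (sigma_finite_copy sf) p n F G p1 LF.1 LG.1 FG bs
  (fun=> 0).
have K0 := gauss_pow1_gt0 p; have Koo := gauss_pow1_lty (ltW p0).
have Kfin : gauss_pow p 1 0 \is a fin_num by rewrite ge0_fin_numE ?ltW.
have Kpos : 0 < fine (gauss_pow p 1 0) by apply: fine_gt0; rewrite K0 Koo.
have step H : Lp_family mu p H ->
  (\int[mu]_x gauss_pow p (\sum_(b <- bs) (\sum_i b i * H i x) ^+ 2)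
      (\sum_i 0 * H i x) =
    (fine (gauss_pow p 1 0))%:E * \int[mu]_x (quad bs (H^~ x) `^ (p / 2))%:E)%E.
  move=> [mH _].
  transitivity (\int[mu]_x ((fine (gauss_pow p 1 0))%:E *
      (quad bs (H^~ x) `^ (p / 2))%:E))%E.
    apply: eq_integral => x _.
    rewrite (_ : \sum_i 0 * H i x = 0); last by rewrite big1// => i; rewrite mul0r.
    apply: etrans (gauss_pow_center p0 (quad_ge0 bs (H^~ x))) _.
    by rewrite fineK// muleC.
  apply: ge0_integralZl_EFin => //.
  - by move=> x _; rewrite lee_fin powR_ge0.
  - apply/measurable_EFinP; apply: (measurableT_comp (measurable_powR _)) => //.
    apply: measurable_sum => b; apply: measurable_funX.
    by apply: measurable_sum => i; exact: measurable_funM.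
  - exact: ltW.
rewrite (step F LF) (step G LG).
exact: mule_fin_inj.
Qed.

(** The coordinate forms, put in front of [bs], contribute |y|^2 and make the quadratic form
    positive definite. *)
Lemma quad_Rintegral_eq bs :
  \int[mu]_x (nsq (F^~ x) + quad bs (F^~ x)) `^ (p / 2) =
  \int[mu]_x (nsq (G^~ x) + quad bs (G^~ x)) `^ (p / 2).
Proof.
have := quad_integral_eq ([seq @delta R n i | i <- enum 'I_n] ++ bs).
under eq_integral do rewrite quad_cat -nsqE.
under [in RHS]eq_integral do rewrite quad_cat -nsqE.
by rewrite /Rintegral => ->.
Qed.

End moments.

(** * Derivatives of powers of quadratic forms *)

Section mom.
Context (R : realType) (n : nat) (p : R).
Hypothesis p0 : 0 < p.
Hypothesis pN : forall m : nat, p / 2 != m%:R.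
Implicit Types (y : 'I_n -> R) (vs bs : seq ('I_n -> R)).

(* Homogeneous of degree p, whence the bound by a multiple of [nsq y `^ (p / 2)];
   both vanish at [y = 0] because [0 `^ r = 0] for every [r != 0]. *)
Definition mom vs bs y :=
  (\prod_(v <- vs) dot v y ^+ 2) *
  (nsq y + quad bs y) `^ (p / 2 - (size vs)%:R).

Lemma mom_ge0 vs bs y : 0 <= mom vs bs y.
Proof. by rewrite mulr_ge0 ?powR_ge0// prodr_ge0// => v _; exact: sqr_ge0. Qed.

Lemma prod_dot_le vs y :
  \prod_(v <- vs) dot v y ^+ 2 <= (\prod_(v <- vs) nsq v) * nsq y ^+ size vs.
Proof.
elim: vs => [|v vs IH]; first by rewrite !big_nil expr0 mulr1.
rewrite !big_cons /= (exprS _ (size vs)) mulrACA ler_pM ?sqr_ge0 ?dot_sqr_le//.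
by apply: prodr_ge0 => u _; exact: sqr_ge0.
Qed.

Lemma mom_le vs bs y :
  mom vs bs y <= (\prod_(v <- vs) nsq v) *
    (1 + \sum_(b <- bs) nsq b) `^ `|p / 2 - (size vs)%:R| * nsq y `^ (p / 2).
Proof.
set r := p / 2 - _; set Q := \sum_(b <- bs) nsq b.
have P0 : 0 <= \prod_(v <- vs) nsq v by apply: prodr_ge0 => v _; exact: nsq_ge0.
have [y0|y0] := eqVneq (nsq y) 0.
  have q0 : quad bs y = 0.
    apply/eqP; rewrite eq_le quad_ge0 andbT.
    by apply: le_trans (quad_le bs y) _; rewrite y0 mulr0.
  rewrite /mom y0 q0 addr0 powR0 ?mulr0 ?mulr_ge0 ?powR_ge0//.
  by rewrite subr_eq0 pN.
have y1 : 0 < nsq y by rewrite lt_neqAle eq_sym y0 nsq_ge0.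
have SE : nsq y + quad bs y = nsq y * (1 + quad bs y / nsq y).
  by field.
have z0 : 0 <= quad bs y / nsq y by rewrite divr_ge0 ?quad_ge0 ?nsq_ge0.
have zQ : quad bs y / nsq y <= Q by rewrite ler_pdivrMr// quad_le.
rewrite /mom -/r SE powRM ?nsq_ge0 ?addr_ge0//.
have -> : nsq y `^ (p / 2) = nsq y ^+ size vs * nsq y `^ r.
  rewrite -powR_mulrn ?nsq_ge0// -powRD; last by rewrite y0 implybT.
  by rewrite /r addrC subrK.
rewrite mulrA [leRHS](_ : _ = (\prod_(v <- vs) nsq v) * nsq y ^+ size vs *
   nsq y `^ r * (1 + Q) `^ `|r|); last by ring.
apply: ler_pM; rewrite ?powR_ge0 ?mulr_ge0//.
- by apply: prodr_ge0 => v _; exact: sqr_ge0.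
- exact: powR_ge0.
- by rewrite ler_wpM2r ?powR_ge0// prod_dot_le.
- by rewrite powR1D_le// z0.
Qed.

Lemma dominated_mom d (T : measurableType d) vs bs : dominated T p (mom vs bs).
Proof.
split; first by eexists=> y; rewrite (ger0_norm (mom_ge0 _ _ _)); exact: mom_le.
move=> H mH.
have mdot b : measurable_fun setT (fun x => dot b (H^~ x)).
  by apply: measurable_sum => i; exact: measurable_funM.
apply: measurable_funM.
  apply: measurable_prod => v _; apply: measurable_funX; exact: mdot.
apply: (measurableT_comp (measurable_powR _)) => //.
apply: measurable_funD; apply: measurable_sum => b; apply: measurable_funX => //.
Qed.

(** For t >= 0 the square root makes the square of the form linear in t. *)
Definition scale_form (t : R) v : 'I_n -> R := fun i => Num.sqrt t * v i.

Lemma mom_taylor vs bs v : exists2 K, 0 <= K & forall t y, 0 <= t <= 1 ->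
  `|mom vs (scale_form t v :: bs) y - mom vs bs y -
     t * (p / 2 - (size vs)%:R) * mom (v :: vs) bs y| <=
  t ^+ 2 * K * nsq y `^ (p / 2).
Proof.
set r := p / 2 - _.
have [C C0 HC] := powR1D_taylor r (nsq_ge0 v).
pose Cm := (\prod_(v <- vs) nsq v) * (1 + \sum_(b <- bs) nsq b) `^ `|r|.
have Cm0 : 0 <= Cm.
  by rewrite mulr_ge0 ?powR_ge0// prodr_ge0// => u _; exact: nsq_ge0.
have K0 : 0 <= C * nsq v ^+ 2 * Cm.
  by apply: mulr_ge0 => //; rewrite mulr_ge0 ?sqr_ge0.
exists (C * nsq v ^+ 2 * Cm) => //.
move=> t y /andP[t0 t1].
have vE : dot (scale_form t v) y ^+ 2 = t * dot v y ^+ 2.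
  by rewrite dotZ exprMn sqr_sqrtr.
have r1 : p / 2 - (size (v :: vs))%:R = r - 1.
  by rewrite /= -[(size vs).+1]addn1 natrD opprD addrA.
have [y0|y0] := eqVneq (nsq y) 0.
  have w0 : dot v y ^+ 2 = 0.
    by apply/eqP; rewrite eq_le sqr_ge0 andbT (le_trans (dot_sqr_le _ _))// y0 mulr0.
  rewrite /mom quad_cons vE big_cons w0 mulr0 add0r !mul0r mulr0 subrr subr0 normr0.
  by apply: mulr_ge0; rewrite ?powR_ge0// mulr_ge0 ?sqr_ge0.
have y1 : 0 < nsq y by rewrite lt_neqAle eq_sym y0 nsq_ge0.
pose S := nsq y + quad bs y.
have S0 : 0 < S by rewrite ltr_pwDl ?quad_ge0.
(* The relative increment of S. By Cauchy-Schwarz it is at most t |v|^2 for every y, which makes the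
   Taylor remainder uniform in y. *)
pose x := t * dot v y ^+ 2 / S.
have x0 : 0 <= x by rewrite divr_ge0 ?(ltW S0)// mulr_ge0 ?sqr_ge0.
have xt : x <= t * nsq v.
  rewrite ler_pdivrMr// -mulrA ler_wpM2l//.
  by apply: le_trans (dot_sqr_le _ _) _; rewrite ler_wpM2l ?nsq_ge0// lerDl quad_ge0.
have xv : x <= nsq v by apply: le_trans xt _; rewrite ler_piMl ?nsq_ge0.
have momE1 : mom vs (scale_form t v :: bs) y = mom vs bs y * (1 + x) `^ r.
  rewrite /mom quad_cons vE -/r -mulrA -powRM ?addr_ge0 ?nsq_ge0 ?quad_ge0//.
  by congr (_ * _ `^ _); rewrite /x -/S addrCA -/S; field; rewrite gt_eqF.
have momE2 : t * r * mom (v :: vs) bs y = mom vs bs y * (r * x).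
  rewrite /mom r1 big_cons -/r -/S powRB; last by rewrite (gt_eqF S0) implybT.
  by rewrite powRr1 ?(ltW S0)// /x; field; rewrite gt_eqF.
rewrite momE1 momE2 -[X in _ - X - _]mulr1 -!mulrBr normrM (ger0_norm (mom_ge0 _ _ _)).
apply: (@le_trans _ _ (Cm * nsq y `^ (p / 2) * (C * (t * nsq v) ^+ 2))).
  apply: ler_pM; rewrite ?mom_ge0 ?mom_le//.
  apply: le_trans (HC _ _) _; first by rewrite x0.
  by rewrite ler_wpM2l// lerXn2r// nnegrE// mulr_ge0 ?nsq_ge0.
by rewrite le_eqVlt; apply/orP; left; apply/eqP; ring.
Qed.

End mom.

(** * Equality of the moments by differentiation *)

Section moments.
Context d (T : measurableType d) (R : realType).
Variables (mu : {measure set T -> \bar R}) (n : nat) (p : R).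
Hypothesis p0 : 0 < p.
Implicit Types (H F G : 'I_n -> T -> R) (h k : ('I_n -> R) -> R).

Lemma dominatedB h k : dominated T p h -> dominated T p k ->
  dominated T p (fun y => h y - k y).
Proof.
move=> dh dk; have := dominatedD dh (dominatedZ (-1) dk).
by under eq_fun do rewrite mulN1r.
Qed.

Lemma Rintegral_dominatedB H h k : Lp_family mu p H ->
  dominated T p h -> dominated T p k ->
  \int[mu]_x (h (H^~ x) - k (H^~ x)) =
  \int[mu]_x h (H^~ x) - \int[mu]_x k (H^~ x).
Proof.
by move=> LH dh dk; apply: RintegralB => //; exact: (dominated_integrable p0 LH).
Qed.

Lemma Rintegral_dominatedZ H (c : R) h : Lp_family mu p H -> dominated T p h ->
  \int[mu]_x (c * h (H^~ x)) = c * \int[mu]_x h (H^~ x).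
Proof.
by move=> LH dh; apply: RintegralZl => //; exact: (dominated_integrable p0 LH).
Qed.

Lemma Rintegral_dominated_le H h k : Lp_family mu p H ->
  dominated T p h -> dominated T p k -> (forall y, h y <= k y) ->
  \int[mu]_x h (H^~ x) <= \int[mu]_x k (H^~ x).
Proof.
by move=> LH dh dk hk; apply: le_Rintegral => //; exact: (dominated_integrable p0 LH).
Qed.

Lemma Rintegral_dominated_norm H h (C : R) : Lp_family mu p H ->
  dominated T p h -> (forall y, `|h y| <= C * nsq y `^ (p / 2)) ->
  `|\int[mu]_x h (H^~ x)| <= C * \int[mu]_x nsq (H^~ x) `^ (p / 2).
Proof.
move=> LH dh hC.
have dn := dominated_nsq T n p.
rewrite -(Rintegral_dominatedZ C LH dn) ler_norml; apply/andP; split.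
  rewrite -mulN1r -(Rintegral_dominatedZ (-1) LH (dominatedZ C dn)).
  apply: (@Rintegral_dominated_le H (fun y => -1 * (C * nsq y `^ (p / 2))) h) => //.
    by do 2 apply: dominatedZ.
  by move=> y; rewrite mulN1r; have := hC y; rewrite ler_norml => /andP[].
apply: (@Rintegral_dominated_le H h (fun y => C * nsq y `^ (p / 2))) => //.
  exact: dominatedZ.
by move=> y; apply: le_trans (hC y); exact: ler_norm.
Qed.

Variables F G : 'I_n -> T -> R.
Hypothesis sf : sigma_finite setT mu.
Hypothesis p1 : 1 <= p.
Hypothesis pN : forall m : nat, p / 2 != m%:R.
Hypothesis LF : Lp_family mu p F.
Hypothesis LG : Lp_family mu p G.
Hypothesis FG : forall a : 'I_n -> R,
  (\int[mu]_x (`|dot a (F^~ x)| `^ p)%:E = \int[mu]_x (`|dot a (G^~ x)| `^ p)%:E)%E.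

(* Each form in [vs] is produced by differentiating at [t = 0] along the family
   [scale_form t v :: bs]. *)
Lemma mom_integral_eq vs bs :
  \int[mu]_x mom p vs bs (F^~ x) = \int[mu]_x mom p vs bs (G^~ x).
Proof.
elim: vs bs => [|v vs IH] bs.
  have E y : mom p [::] bs y = (nsq y + quad bs y) `^ (p / 2).
    by rewrite /mom big_nil mul1r subr0.
  under eq_Rintegral do rewrite E.
  under [RHS]eq_Rintegral do rewrite E.
  exact: quad_Rintegral_eq.
have [K K0 HK] := mom_taylor pN vs bs v.
set r := p / 2 - (size vs)%:R in HK.
pose D := \int[mu]_x mom p (v :: vs) bs (F^~ x) -
  \int[mu]_x mom p (v :: vs) bs (G^~ x).
pose N := \int[mu]_x nsq (F^~ x) `^ (p / 2) + \int[mu]_x nsq (G^~ x) `^ (p / 2).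
have N0 : 0 <= N by rewrite addr_ge0// Rintegral_ge0// => x _; exact: powR_ge0.
have dm := dominated_mom pN T.
have bnd t : 0 < t <= 1 -> `|r * D| <= t * (K * N).
  move=> /andP[t0 t1].
  pose e y := mom p vs (scale_form t v :: bs) y - mom p vs bs y -
    t * r * mom p (v :: vs) bs y.
  have de : dominated T p e.
    by apply: dominatedB; [apply: dominatedB; exact: dm|apply: dominatedZ; exact: dm].
  have eI H : Lp_family mu p H -> \int[mu]_x e (H^~ x) =
      \int[mu]_x mom p vs (scale_form t v :: bs) (H^~ x) -
      \int[mu]_x mom p vs bs (H^~ x) -
      t * r * \int[mu]_x mom p (v :: vs) bs (H^~ x).
    move=> LH; rewrite -(Rintegral_dominatedZ _ LH (dm _ _ _)).
    rewrite -(Rintegral_dominatedB LH (dm _ _ _) (dm _ _ _)).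
    rewrite -(Rintegral_dominatedB LH (dominatedB (dm _ _ _) (dm _ _ _))
      (dominatedZ _ (dm _ _ _))).
    by [].
  have eB H : Lp_family mu p H -> `|\int[mu]_x e (H^~ x)| <=
      t ^+ 2 * K * \int[mu]_x nsq (H^~ x) `^ (p / 2).
    move=> LH; apply: Rintegral_dominated_norm => // y.
    by apply: HK; rewrite (ltW t0).
  rewrite -(ler_pM2l t0) -[X in X * _ <= _](gtr0_norm t0) -normrM.
  (* By induction the first two integrals in [eI] agree for F and G, so only the derivative term
     survives in the difference of two remainders of order t^2. *)
  have -> : t * (r * D) = \int[mu]_x e (G^~ x) - \int[mu]_x e (F^~ x).
    rewrite (eI F LF) (eI G LG) (IH bs) (IH (scale_form t v :: bs)) /D.
    move: (\int[mu]_x _) (\int[mu]_x _) (\int[mu]_x _) (\int[mu]_x _) => a b c e'.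
    ring.
  apply: (le_trans (ler_normB _ _)).
  apply: (le_trans (lerD (eB _ LG) (eB _ LF))).
  by rewrite -mulrDr addrC -/N expr2 !mulrA.
have rD0 : r * D = 0.
  apply/eqP/negPn/negP => rD; have rD1 : 0 < `|r * D| by rewrite normr_gt0.
  have KN0 : 0 <= K * N by rewrite mulr_ge0.
  (* Chosen so that t K N < |r D|, which contradicts [bnd]. *)
  pose t := `|r * D| / (2 * (K * N + `|r * D|)).
  have den : 0 < 2 * (K * N + `|r * D|) by rewrite mulr_gt0// ltr_wpDl.
  have t0 : 0 < t by rewrite divr_gt0.
  have t1 : t <= 1 by rewrite ler_pdivrMr// mul1r; nra.
  have := bnd t; rewrite t0 t1 => /(_ isT).
  rewrite /t mulrAC ler_pdivlMr//.
  by rewrite leNgt => /negP; apply; nra.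
(* Here r = p / 2 - [size vs] is nonzero because p / 2 is not a natural number. *)
apply/eqP; rewrite -subr_eq0; move/eqP: rD0; rewrite mulf_eq0 => /orP[|//].
by rewrite /r (subr_eq0 (p / 2)) (negbTE (pN _)).
Qed.

End moments.

(** * The partition of unity *)

Section weights.
Context (R : realType) (n : nat).
Implicit Types (y : 'I_n -> R).

Definition letter : finType := ('I_n * 'I_n * bool)%type.

(* The forms y_a + y_b and y_a - y_b: their squares add up to 4 n |y|^2, and their
   differences recover the products y_a y_b. *)
Definition letter_form (j : letter) : 'I_n -> R :=
  fun i => delta R j.1.1 i + (-1) ^+ j.2 * delta R j.1.2 i.

(* At [y = 0] all the weights are [0], since [x / 0 = 0]. *)
Definition wt (j : letter) y := dot (letter_form j) y ^+ 2 / (n%:R *+ 4 * nsq y).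

(* Matrix entries of the orthogonal projection onto the line spanned by [y]. *)
Definition line_proj (a b : 'I_n) y := y a * y b / nsq y.

(* A letter drawn with probabilities [wt ^~ y] has expected score [line_proj a b y]. *)
Definition score (a b : 'I_n) (j : letter) : R :=
  if j.1 == (a, b) then (-1) ^+ j.2 * n%:R else 0.

Lemma dot_letter_form j y : dot (letter_form j) y = y j.1.1 + (-1) ^+ j.2 * y j.1.2.
Proof.
rewrite -[y j.1.1]dot_delta -[y j.1.2]dot_delta /dot mulr_sumr -big_split/=.
by apply: eq_bigr => i _; rewrite /letter_form mulrDl mulrA.
Qed.

Lemma sum_letter (f : letter -> R) :
  \sum_j f j = \sum_a \sum_b (f (a, b, false) + f (a, b, true)).
Proof.
transitivity (\sum_(ab : 'I_n * 'I_n) \sum_(s : bool) f (ab, s)).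
  by rewrite pair_bigA; apply: eq_bigr => -[].
by rewrite [RHS]pair_bigA; apply: eq_bigr => -[a b] _; rewrite big_bool addrC.
Qed.

Lemma wt_ge0 j y : 0 <= wt j y.
Proof. by rewrite divr_ge0 ?sqr_ge0// mulr_ge0 ?nsq_ge0// mulrn_wge0. Qed.

Lemma wt_sum y : nsq y != 0 -> \sum_j wt j y = 1.
Proof.
move=> y0; rewrite -mulr_suml sum_letter.
have n0 : (n%:R : R) != 0.
  by move: y0; rewrite pnatr_eq0 /nsq; case: (n) y => //= y; rewrite big_ord0 eqxx.
suff -> : \sum_a \sum_b (dot (letter_form (a, b, false)) y ^+ 2 +
    dot (letter_form (a, b, true)) y ^+ 2) = n%:R *+ 4 * nsq y.
  by rewrite divff// mulf_neq0// -mulr_natr mulf_neq0// pnatr_eq0.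
transitivity (\sum_a \sum_b (2 * y a ^+ 2 + 2 * y b ^+ 2)).
  by apply: eq_bigr => a _; apply: eq_bigr => b _; rewrite !dot_letter_form/=; ring.
transitivity (\sum_a (n%:R * (2 * y a ^+ 2) + 2 * nsq y)).
  apply: eq_bigr => a _.
  by rewrite big_split/= sumr_const card_ord -[_ *+ n]mulr_natl -mulr_sumr.
rewrite big_split/= sumr_const card_ord -[_ *+ n]mulr_natl -!mulr_sumr -/(nsq y).
ring.
Qed.

Lemma wt_score a b y : nsq y != 0 ->
  \sum_j wt j y * score a b j = line_proj a b y.
Proof.
move=> y0; rewrite sum_letter (bigD1 a)//= (bigD1 b)//= ?big1; last 2 first.
- move=> c ca; rewrite big1// => e _.
  by rewrite /score/= xpair_eqE (negbTE ca) !mulr0 addr0.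
- by move=> c cb; rewrite /score/= xpair_eqE eqxx (negbTE cb) !mulr0 addr0.
have n0 : (n%:R : R) != 0.
  by rewrite pnatr_eq0 -lt0n (leq_trans _ (ltn_ord a)).
rewrite /wt /score /line_proj /= !eqxx !dot_letter_form/=.
by field; rewrite y0 n0.
Qed.

(** Polarization: (y_a + y_b)^2 - (y_a - y_b)^2 = 4 y_a y_b. Integrals involving [line_proj] thereby
    reduce to integrals of products of weights. *)
Lemma wt_line_proj a b y :
  line_proj a b y = n%:R * (wt (a, b, false) y - wt (a, b, true) y).
Proof.
have [y0|y0] := eqVneq (nsq y) 0.
  by rewrite /line_proj /wt y0 mulr0 invr0 !mulr0 subrr mulr0.
have n0 : (n%:R : R) != 0.
  by rewrite pnatr_eq0 -lt0n (leq_trans _ (ltn_ord a)).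
by rewrite /line_proj /wt !dot_letter_form/=; field; rewrite y0 n0.
Qed.

Lemma wt0 j y : nsq y = 0 -> wt j y = 0.
Proof. by move=> y0; rewrite /wt y0 mulr0 invr0 mulr0. Qed.

Lemma wt_le1 j y : wt j y <= 1.
Proof.
have [y0|y0] := eqVneq (nsq y) 0; first by rewrite wt0.
by rewrite -(wt_sum y0) (bigD1 j)//= lerDl sumr_ge0// => i _; exact: wt_ge0.
Qed.

Lemma line_proj_le1 a b y : `|line_proj a b y| <= 1.
Proof.
have [y0|y0] := eqVneq (nsq y) 0.
  by rewrite /line_proj y0 invr0 mulr0 normr0.
have y1 : 0 < nsq y by rewrite lt_neqAle eq_sym y0 nsq_ge0.
rewrite normrM [X in _ * X]gtr0_norm ?invr_gt0// ler_pdivrMr// mul1r.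
have H c : `|y c| ^+ 2 <= nsq y.
  rewrite real_normK ?num_real// /nsq (bigD1 c)//= lerDl.
  by apply: sumr_ge0 => i _; exact: sqr_ge0.
rewrite normrM; have := H a; have := H b.
by have := sqr_ge0 (`|y a| - `|y b|); nra.
Qed.

Lemma sum_line_proj a y : \sum_b y b * line_proj a b y = y a.
Proof.
have [y0|y0] := eqVneq (nsq y) 0.
  rewrite (nsq_eq0 a y0) big1// => i _.
  by rewrite (nsq_eq0 i y0) mul0r.
transitivity (y a / nsq y * nsq y); last by rewrite divfK.
by rewrite /nsq mulr_sumr; apply: eq_bigr => i _; rewrite /line_proj; ring.
Qed.

Variable N : nat.
Definition word : finType := {ffun 'I_N -> letter}.
Definition letters (k : word) : seq letter := [seq k l | l <- index_enum 'I_N].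
(** Defined on arbitrary sequences rather than words, because [line_proj_wpow] adds a letter. *)
Definition wts (s : seq letter) y := \prod_(j <- s) wt j y.

Lemma wtsE k y : wts (letters k) y = \prod_l wt (k l) y.
Proof. by rewrite /wts big_map. Qed.

Lemma wts_ge0 s y : 0 <= wts s y.
Proof. by apply: prodr_ge0 => j _; exact: wt_ge0. Qed.

Lemma wts_le1 s y : wts s y <= 1.
Proof.
rewrite /wts; elim: s => [|j s IH]; first by rewrite big_nil.
by rewrite big_cons mulr_ile1 ?wt_ge0 ?wt_le1 ?wts_ge0.
Qed.

Lemma wts_sum y : nsq y != 0 -> \sum_(k : word) wts (letters k) y = 1.
Proof.
move=> y0; under eq_bigr do rewrite wtsE.
rewrite -(bigA_distr_bigA (fun _ j => wt j y)) big1// => l _.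
exact: wt_sum.
Qed.

Definition mean_score a b (k : word) : R := (\sum_l score a b (k l)) / N%:R.

(** For the probabilities [wts (letters k) y] the letters of k are independent with law [wt ^~ y].
    The variance of their mean score is thus that of one score divided by N, and a score has modulus
    at most n. *)
Lemma wts_variance a b y : (0 < N)%N -> nsq y != 0 ->
  \sum_(k : word) wts (letters k) y * (mean_score a b k - line_proj a b y) ^+ 2 <=
  n%:R ^+ 2 / N%:R.
Proof.
move=> N0 y0.
have NR : (N%:R : R) != 0 by rewrite pnatr_eq0 -lt0n.
pose z j := score a b j - line_proj a b y.
have Ez : \sum_j wt j y * z j = 0.
  under eq_bigr do rewrite mulrBr.
  by rewrite sumrB -mulr_suml wt_sum// mul1r wt_score// subrr.
have Ez2 : \sum_j wt j y * z j ^+ 2 <= n%:R ^+ 2.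
  have E : \sum_j wt j y * z j ^+ 2 =
      \sum_j wt j y * score a b j ^+ 2 - line_proj a b y ^+ 2.
    transitivity (\sum_j (wt j y * score a b j ^+ 2 -
       (wt j y * score a b j) * (line_proj a b y *+ 2) + wt j y * line_proj a b y ^+ 2)).
      by apply: eq_bigr => j _; rewrite /z; ring.
    rewrite big_split sumrB/= -2!mulr_suml wt_sum// wt_score//; ring.
  rewrite E; apply: (@le_trans _ _ (\sum_j wt j y * n%:R ^+ 2)).
    rewrite lerBlDr; apply: (@le_trans _ _ (\sum_j wt j y * n%:R ^+ 2)).
      apply: ler_sum => j _; rewrite ler_wpM2l ?wt_ge0// /score.
      case: ifP => _; last by rewrite expr0n sqr_ge0.
      by rewrite exprMn sqrr_sign mul1r.
    by rewrite lerDl sqr_ge0.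
  by rewrite -mulr_suml wt_sum// mul1r.
(* This writes z (k l) z (k l') as a product over all positions m, so that the sum over words
   factors. Off the diagonal a factor of mean 0 remains. *)
pose c (l l' m : 'I_N) (j : letter) : R :=
    (if m == l then z j else 1) * (if m == l' then z j else 1).
have cE l l' (k : word) : wts (letters k) y * (z (k l) * z (k l')) =
    \prod_m (wt (k m) y * c l l' m (k m)).
  rewrite wtsE [RHS]big_split/=; congr (_ * _).
  rewrite /c [RHS]big_split/=; congr (_ * _).
    by rewrite -big_mkcond/= big_pred1_eq.
  by rewrite -big_mkcond/= big_pred1_eq.
have ccE l l' : \sum_(k : word) wts (letters k) y * (z (k l) * z (k l')) =
    if l == l' then \sum_j wt j y * z j ^+ 2 else 0.
  under eq_bigr do rewrite cE.
  rewrite -(bigA_distr_bigA (fun m j => wt j y * c l l' m j)) (bigD1 l)//=.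
  case: eqVneq => [<-|ll'].
    rewrite [X in _ * X](_ : _ = 1) ?mulr1; last first.
      rewrite big1// => m ml; under eq_bigr do rewrite /c (negbTE ml) !mulr1.
      exact: wt_sum.
    by apply: eq_bigr => j _; rewrite /c eqxx expr2.
  rewrite [X in X * _](_ : _ = 0) ?mul0r// -[RHS]Ez.
  by apply: eq_bigr => j _; rewrite /c eqxx (negbTE ll') mulr1.
have mE k : (mean_score a b k - line_proj a b y) ^+ 2 =
    N%:R ^- 2 * \sum_l \sum_l' z (k l) * z (k l').
  have -> : mean_score a b k - line_proj a b y = N%:R^-1 * \sum_l z (k l).
    have -> : \sum_l z (k l) = \sum_l score a b (k l) - N%:R * line_proj a b y.
      by rewrite /z sumrB sumr_const card_ord -[_ *+ N]mulr_natl.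
    by rewrite /mean_score; field.
  rewrite exprMn exprVn; congr (_ * _).
  by rewrite expr2 mulr_suml; apply: eq_bigr => l _; rewrite mulr_sumr.
under eq_bigr do rewrite mE mulrCA.
rewrite -mulr_sumr.
under eq_bigr do rewrite mulr_sumr.
rewrite exchange_big/=.
rewrite (eq_bigr (fun l => \sum_j wt j y * z j ^+ 2)); last first.
  move=> l _; under eq_bigr do rewrite mulr_sumr.
  rewrite exchange_big/= (eq_bigr _ (fun l' _ => ccE l l')).
  rewrite (bigD1 l)//= eqxx [X in _ + X]big1 ?addr0// => l' ll'.
  by rewrite eq_sym (negbTE ll').
move: (\sum_j wt j y * z j ^+ 2) Ez2 => V Ez2.
rewrite sumr_const card_ord -(mulr_natl V) mulrA.
have -> : (N%:R ^- 2 * N%:R : R) = N%:R^-1 by field.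
by rewrite mulrC ler_wpM2r// invr_ge0.
Qed.

End weights.

(** * Integrals against the weights *)

Section weighted_integrals.
Context d (T : measurableType d) (R : realType).
Variables (mu : {measure set T -> \bar R}) (n : nat) (p : R).
Hypothesis p0 : 0 < p.
Hypothesis pN : forall m : nat, p / 2 != m%:R.
Implicit Types (H F G : 'I_n -> T -> R) (s : seq (letter n)) (y : 'I_n -> R).

Lemma measurable_nsq H : (forall i, measurable_fun setT (H i)) ->
  measurable_fun setT (fun x => nsq (H^~ x)).
Proof. by move=> mH; apply: measurable_sum => i; exact: measurable_funX. Qed.

Lemma measurable_wt H j : (forall i, measurable_fun setT (H i)) ->
  measurable_fun setT (fun x => wt j (H^~ x)).
Proof.
move=> mH; rewrite (_ : (fun _ => _) = fun x =>
    dot (letter_form R j) (H^~ x) ^+ 2 * (n%:R *+ 4 * nsq (H^~ x)) `^ (-1)).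
  apply: measurable_funM.
    apply: measurable_funX; apply: measurable_sum => i; exact: measurable_funM.
  apply: (measurableT_comp (measurable_powR _)) => //.
  by apply: measurable_funM => //; exact: measurable_nsq.
apply/funext => x; rewrite powR_inv1// mulr_ge0 ?nsq_ge0//.
Qed.

Lemma measurable_wts H s : (forall i, measurable_fun setT (H i)) ->
  measurable_fun setT (fun x => wts s (H^~ x)).
Proof. by move=> mH; apply: measurable_prod => j _; exact: measurable_wt. Qed.

Lemma measurable_line_proj H a b : (forall i, measurable_fun setT (H i)) ->
  measurable_fun setT (fun x => line_proj a b (H^~ x)).
Proof.
move=> mH; under eq_fun do rewrite wt_line_proj.
by apply: measurable_funM => //; apply: measurable_funB; exact: measurable_wt.
Qed.

(** Since [nsq y] is |y|^2, the second factor is |y|^p. *)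
Definition wpow s y : R := wts s y * nsq y `^ (p / 2).

Lemma wpow_ge0 s y : 0 <= wpow s y.
Proof. by rewrite mulr_ge0 ?wts_ge0 ?powR_ge0. Qed.

(** Each letter brings a squared form divided by 4 n |y|^2 and so lowers the exponent of |y|^2 by
    one, as each form does in [mom]. *)
Lemma wpow_mom s y :
  wpow s y = (n%:R *+ 4) ^- size s * mom p [seq letter_form R j | j <- s] [::] y.
Proof.
have [y0|y0] := eqVneq (nsq y) 0.
  rewrite /wpow y0 powR0 ?mulr0; last by rewrite mulf_neq0 ?gt_eqF.
  suff -> : mom p [seq letter_form R j | j <- s] [::] y = 0 by rewrite mulr0.
  apply/eqP; rewrite eq_le mom_ge0 andbT.
  apply: le_trans (mom_le pN _ _ _) _.
  by rewrite y0 powR0 ?mulr0// mulf_neq0 ?gt_eqF.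
have n0 : (n%:R : R) != 0.
  by rewrite pnatr_eq0; move: y0; rewrite /nsq; case: (n) y => //= y; rewrite big_ord0 eqxx.
have n4 : (n%:R *+ 4 : R) != 0 by rewrite (mulrn_eq0 _ 4).
have -> : mom p [seq letter_form R j | j <- s] [::] y =
    (\prod_(j <- s) dot (letter_form R j) y ^+ 2) * (nsq y `^ (p / 2) / nsq y ^+ size s).
  rewrite /mom big_map size_map /quad big_nil addr0 powRB; last first.
    by rewrite y0 implybT.
  by rewrite powR_mulrn ?nsq_ge0.
have W : wts s y = (n%:R *+ 4) ^- size s *
    (\prod_(j <- s) dot (letter_form R j) y ^+ 2) / nsq y ^+ size s.
  rewrite /wts; elim: s => [|j s IH]; first by rewrite !big_nil /=; field.
  rewrite !big_cons IH /wt /= !exprS; field.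
  by rewrite !expf_neq0 ?y0 ?n0 ?n4.
by rewrite /wpow W -!mulrA; congr (_ * (_ * _)); rewrite mulrC.
Qed.

Lemma dominated_wpow s : dominated T p (wpow s).
Proof.
have := dominatedZ ((n%:R *+ 4) ^- size s)
  (dominated_mom pN T [seq letter_form R j | j <- s] [::]).
by under eq_fun do rewrite -wpow_mom.
Qed.

Lemma dominated_line_proj_wpow a b s :
  dominated T p (fun y => line_proj a b y * wpow s y).
Proof.
apply: dominatedM (dominated_wpow s); first exact: line_proj_le1.
by move=> H mH; exact: measurable_line_proj.
Qed.

Lemma line_proj_wpow a b s y : line_proj a b y * wpow s y =
  n%:R * (wpow ((a, b, false) :: s) y - wpow ((a, b, true) :: s) y).
Proof. by rewrite wt_line_proj /wpow /wts !big_cons; ring. Qed.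

End weighted_integrals.

Section integrable_real.
Context d (T : measurableType d) (R : realType).
Variables (mu : {measure set T -> \bar R}).
Implicit Types f g : T -> R.

Lemma integrable_le f g : measurable_fun setT f ->
  mu.-integrable setT (EFin \o g) -> (forall x, `|f x| <= g x) ->
  mu.-integrable setT (EFin \o f).
Proof.
move=> mf ig fg; apply: (le_integrable measurableT _ _ ig).
  exact/measurable_EFinP.
by move=> x _; rewrite /= lee_fin (le_trans (fg x))// ler_norm.
Qed.

Lemma integrable_add f g : mu.-integrable setT (EFin \o f) ->
  mu.-integrable setT (EFin \o g) -> mu.-integrable setT (EFin \o (fun x => f x + g x)).
Proof. by move=> If Ig; exact: (integrableD measurableT If Ig). Qed.

Lemma integrable_scale (c : R) f : mu.-integrable setT (EFin \o f) ->
  mu.-integrable setT (EFin \o (fun x => c * f x)).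
Proof. by move=> If; exact: (integrableZl measurableT c If). Qed.

Lemma integrable_bigsum (I : finType) (f : I -> T -> R) :
  (forall i, mu.-integrable setT (EFin \o f i)) ->
  mu.-integrable setT (EFin \o (fun x => \sum_i f i x)).
Proof.
move=> If; rewrite (_ : _ \o _ = fun x => (\sum_i (f i x)%:E)%E).
  by apply: integrable_sum => // i _; exact: If.
by apply/funext => x /=; rewrite sumEFin.
Qed.

Lemma Rintegral_bigsum (I : finType) (f : I -> T -> R) :
  (forall i, mu.-integrable setT (EFin \o f i)) ->
  \int[mu]_x (\sum_i f i x) = \sum_i \int[mu]_x f i x.
Proof.
move=> If; elim: (index_enum I) => [|i s IH].
  under eq_Rintegral do rewrite big_nil.
  by rewrite big_nil /Rintegral integral0.
rewrite big_cons -IH -RintegralD//.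
  by apply: eq_Rintegral => x _; rewrite big_cons.
elim: s {IH} => [|j s IH].
  rewrite (_ : _ \o _ = cst 0%E) ?integrable0//.
  by apply/funext => x /=; rewrite big_nil.
rewrite (_ : _ \o _ = EFin \o (fun x => f j x + \sum_(j <- s) f j x)).
  exact: integrable_add.
by apply/funext => x /=; rewrite big_cons.
Qed.

End integrable_real.

(** Average the tangent line of t^p at the mean s; its linear term averages to 0. *)
Lemma powR_jensen (R : realType) (I : finType) (w b : I -> R) (p : R) : 1 <= p ->
  (forall i, 0 <= w i) -> (forall i, 0 <= b i) -> \sum_i w i = 1 ->
  (\sum_i w i * b i) `^ p <= \sum_i w i * b i `^ p.
Proof.
move=> p1 w0 b0 w1; set s := \sum_i w i * b i.
have s0 : 0 <= s by apply: sumr_ge0 => i _; rewrite mulr_ge0.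
apply: (@le_trans _ _ (\sum_i w i * (s `^ p + p * s `^ (p - 1) * (b i - s)))).
  under eq_bigr do rewrite mulrDr [X in _ + X]mulrCA mulrBr.
  rewrite big_split/= -mulr_suml w1 mul1r -mulr_sumr sumrB -/s -mulr_suml w1.
  by rewrite mul1r subrr mulr0 addr0.
by apply: ler_sum => i _; rewrite ler_wpM2l// powR_tangent.
Qed.

(** * Jensen's inequality over the words *)

Section contraction.
Context d (T : measurableType d) (R : realType).
Variables (mu : {measure set T -> \bar R}) (n N : nat) (p : R).
Hypothesis p1 : 1 <= p.
Hypothesis pN : forall m : nat, p / 2 != m%:R.
Hypothesis N0 : (0 < N)%N.
Implicit Types (H F G : 'I_n -> T -> R) (y : 'I_n -> R) (k : word n N).

Let p0 : 0 < p. Proof. exact: lt_le_trans p1. Qed.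

(** At y = F x this is the operator of the partition of unity with unspecified coefficient vectors:
    the sum of w_k(F x) <F x, c_k>. *)
Definition kernel_sum (c : word n N -> 'I_n -> R) y : R :=
  \sum_k wts (letters k) y * \sum_j y j * c k j.

Lemma wts0 k y : nsq y = 0 -> wts (letters k) y = 0.
Proof.
(* N > 0 matters: the empty product would be 1. *)
by move=> y0; rewrite wtsE (bigD1 (Ordinal N0))//= wt0 ?mul0r.
Qed.

Lemma wts_sum_le1 y : \sum_(k : word n N) wts (letters k) y <= 1.
Proof.
have [y0|y0] := eqVneq (nsq y) 0; last by rewrite wts_sum.
by rewrite big1// => k _; rewrite wts0.
Qed.

Lemma sqrt_nsq_powR y : Num.sqrt (nsq y) `^ p = nsq y `^ (p / 2).
Proof. by rewrite -powR12_sqrt ?nsq_ge0// -powRrM mulrC. Qed.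

(** First use of Jensen: the kernel sum is at most |y| times the mean of b under the probabilities
    [wts (letters k) y]. *)
Lemma kernel_sum_le c b y : (forall k, 0 <= b k) ->
  (forall k y, `|\sum_j y j * c k j| <= Num.sqrt (nsq y) * b k) ->
  `|kernel_sum c y| `^ p <= \sum_k b k `^ p * wpow p (letters k) y.
Proof.
move=> b0 cb.
have R0 : 0 <= \sum_k b k `^ p * wpow p (letters k) y.
  by apply: sumr_ge0 => k _; rewrite mulr_ge0 ?powR_ge0 ?wpow_ge0.
have [y0|y0] := eqVneq (nsq y) 0.
  rewrite [kernel_sum c y](_ : _ = 0) ?normr0 ?powR0 ?gt_eqF//.
  by rewrite /kernel_sum big1// => k _; rewrite wts0 ?mul0r.
have H : `|kernel_sum c y| <= Num.sqrt (nsq y) * \sum_k wts (letters k) y * b k.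
  apply: le_trans (ler_norm_sum _ _ _) _; rewrite mulr_sumr ler_sum// => k _.
  by rewrite normrM (ger0_norm (wts_ge0 _ _)) mulrCA ler_wpM2l ?wts_ge0.
have S0 : 0 <= \sum_k wts (letters k) y * b k.
  by apply: sumr_ge0 => k _; rewrite mulr_ge0 ?wts_ge0.
apply: (@le_trans _ _ ((Num.sqrt (nsq y) * \sum_k wts (letters k) y * b k) `^ p)).
  by apply: ge0_ler_powR; rewrite ?nnegrE ?(ltW p0) ?mulr_ge0 ?sqrtr_ge0.
rewrite powRM ?sqrtr_ge0// sqrt_nsq_powR.
have := powR_jensen p1 (fun k => wts_ge0 (letters k) y) b0 (wts_sum N y0).
move/(ler_wpM2l (powR_ge0 (nsq y) (p / 2))) => /le_trans; apply.
rewrite mulr_sumr le_eqVlt; apply/orP; left; apply/eqP.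
by apply: eq_bigr => k _; rewrite /wpow; ring.
Qed.

Lemma measurable_kernel_sum c H : (forall i, measurable_fun setT (H i)) ->
  measurable_fun setT (fun x => kernel_sum c (H^~ x)).
Proof.
move=> mH; apply: measurable_sum => k; apply: measurable_funM.
  exact: measurable_wts.
by apply: measurable_sum => j; exact: measurable_funM.
Qed.

Lemma dominated_kernel_sum c : dominated T p (fun y => `|kernel_sum c y| `^ p).
Proof.
pose b k := Num.sqrt (nsq (c k)).
have cb k y : `|\sum_j y j * c k j| <= Num.sqrt (nsq y) * b k.
  rewrite -sqrtr_sqr -sqrtrM ?nsq_ge0//; apply: ler_wsqrtr.
  exact: dot_sqr_le.
have b0 k : 0 <= b k by exact: sqrtr_ge0.
split.
  exists (\sum_k b k `^ p) => y; rewrite ger0_norm ?powR_ge0//.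
  apply: le_trans (kernel_sum_le y b0 cb) _; rewrite mulr_suml ler_sum// => k _.
  by rewrite ler_wpM2l ?powR_ge0// ler_piMl ?powR_ge0// wts_le1.
move=> H mH; apply: (measurableT_comp (measurable_powR _)) => //.
by apply: measurableT_comp => //; exact: measurable_kernel_sum.
Qed.

Lemma kernel_sum_integral_le F c b : Lp_family mu p F -> (forall k, 0 <= b k) ->
  (forall k y, `|\sum_j y j * c k j| <= Num.sqrt (nsq y) * b k) ->
  \int[mu]_x (`|kernel_sum c (F^~ x)| `^ p) <=
  \sum_k b k `^ p * \int[mu]_x wpow p (letters k) (F^~ x).
Proof.
move=> LF b0 cb.
have iw k := dominated_integrable p0 LF (dominated_wpow T p0 pN (letters k)).
pose g k x := b k `^ p * wpow p (letters k) (F^~ x).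
have ig k : mu.-integrable setT (EFin \o g k) by exact: integrable_scale (iw k).
apply: (@le_trans _ _ (\int[mu]_x \sum_k g k x)).
  apply: le_Rintegral => //.
  - exact: (dominated_integrable p0 LF (dominated_kernel_sum c)).
  - exact: integrable_bigsum.
  - by move=> x _; exact: kernel_sum_le.
rewrite Rintegral_bigsum//.
by rewrite ler_sum// => k _; rewrite /g RintegralZl//; exact: iw.
Qed.

End contraction.

(** * The coefficients of the operator and its contractivity *)

Section contraction.
Context d (T : measurableType d) (R : realType).
Variables (mu : {measure set T -> \bar R}) (n N : nat) (p : R).
Hypothesis p1 : 1 <= p.
Hypothesis pN : forall m : nat, p / 2 != m%:R.
Hypothesis N0 : (0 < N)%N.
Implicit Types (y z : 'I_n -> R) (k : word n N) (t b : R).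

Let p0 : 0 < p. Proof. exact: lt_le_trans p1. Qed.

(** This is |y|^(p - 1). *)
Definition npow y : R := nsq y `^ ((p - 1) / 2).

(** This is w_k(y) |y|^(p - 2) y_j. *)
Definition kernel_factor k j y : R := wts (letters k) y * (nsq y `^ ((p - 2) / 2) * y j).

Lemma npowE y : Num.sqrt (nsq y) `^ (p - 1) = npow y.
Proof. by rewrite -powR12_sqrt ?nsq_ge0// -powRrM mulrC. Qed.

Lemma npow_sqrt y : Num.sqrt (nsq y) * npow y = nsq y `^ (p / 2).
Proof. by rewrite -npowE mulr_powRB1 ?sqrtr_ge0// sqrt_nsq_powR. Qed.

(* The tangent line of [t `^ p] at [b |y|], for |y| = sqrt (nsq y). *)
Lemma nsq_tangent b t y : 0 <= b -> 0 <= t ->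
  b `^ p * nsq y `^ (p / 2) +
    p * b `^ (p - 1) * (npow y * t - b * nsq y `^ (p / 2)) <= t `^ p.
Proof.
move=> b0 t0; have r0 := sqrtr_ge0 (nsq y).
apply: le_trans (powR_tangent p1 t0 (mulr_ge0 b0 r0)).
rewrite !powRM// npowE sqrt_nsq_powR lerD2l -npow_sqrt.
by rewrite le_eqVlt; apply/orP; left; apply/eqP; ring.
Qed.

(** A crude Young inequality from the tangent at b = 1; it makes the integrals of u against the
    kernel finite. *)
Lemma npow_young t y : 0 <= t -> npow y * t <= nsq y `^ (p / 2) + t `^ p.
Proof.
move=> t0; have := nsq_tangent y ler01 t0; rewrite !powR1 !mul1r mulr1.
have := powR_ge0 t p; have := powR_ge0 (nsq y) (p / 2).
move: (npow y * t) (nsq y `^ _) (t `^ _) => A B C B0 C0 H.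
suff : p * A <= p * (B + C) by rewrite ler_pM2l.
by have := ler_wpM2r C0 p1; nra.
Qed.

Lemma kernel_factor_le k y z :
  `|\sum_j z j * kernel_factor k j y| <= Num.sqrt (nsq z) * (wts (letters k) y * npow y).
Proof.
have -> : \sum_j z j * kernel_factor k j y =
    wts (letters k) y * (nsq y `^ ((p - 2) / 2) * dot z y).
  by rewrite /dot !mulr_sumr; apply: eq_bigr => j _; rewrite /kernel_factor; ring.
rewrite normrM (ger0_norm (wts_ge0 _ _)) mulrCA ler_wpM2l ?wts_ge0//.
rewrite normrM (ger0_norm (powR_ge0 _ _)).
have H : `|dot z y| <= Num.sqrt (nsq z) * Num.sqrt (nsq y).
  by rewrite -sqrtr_sqr -sqrtrM ?nsq_ge0// ler_wsqrtr// dot_sqr_le.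
apply: (le_trans (ler_wpM2l (powR_ge0 _ _) H)).
rewrite mulrCA ler_wpM2l ?sqrtr_ge0//.
have [->|y0] := eqVneq (nsq y) 0; first by rewrite sqrtr0 mulr0 powR_ge0.
rewrite -powR12_sqrt ?nsq_ge0// -powRD; last by rewrite y0 implybT.
by rewrite /npow le_eqVlt; apply/orP; left; apply/eqP; congr (_ `^ _); field.
Qed.

Lemma kernel_factor_le1 k j y : `|kernel_factor k j y| <= npow y.
Proof.
have := kernel_factor_le k y (delta R j).
have -> : \sum_i delta R j i * kernel_factor k i y = kernel_factor k j y.
  exact: (dot_delta j (fun i => kernel_factor k i y)).
have -> : nsq (delta R j) = 1.
  rewrite /nsq (bigD1 j)//= /delta eqxx expr1n big1 ?addr0// => i /negbTE ->.
  by rewrite expr0n.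
rewrite sqrtr1 mul1r => /le_trans; apply.
by rewrite ler_piMl ?powR_ge0// wts_le1.
Qed.

Variable G : 'I_n -> T -> R.
Hypothesis LG : Lp_family mu p G.
Variable u : T -> R.
Hypothesis mu_u : measurable_fun setT u.
Hypothesis iu : mu.-integrable setT (EFin \o (fun x => `|u x| `^ p)).

Let mG := LG.1.

Let W k := \int[mu]_x wpow p (letters k) (G^~ x).
Definition kernel_coef k j := (\int[mu]_x (kernel_factor k j (G^~ x) * u x)) / W k.
Let m k := \int[mu]_x (wts (letters k) (G^~ x) * (npow (G^~ x) * `|u x|)).
(** The mean of |u| / |G| for the weight w_k(G) |G|^p, or 0 when W k = 0. It bounds the coefficient
    vector of the word k. *)
Let b k := m k / W k.

Let W0 k : 0 <= W k.
Proof. by apply: Rintegral_ge0 => x _; exact: wpow_ge0. Qed.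

Let b0 k : 0 <= b k.
Proof.
apply: divr_ge0 => //; apply: Rintegral_ge0 => x _.
by rewrite !mulr_ge0 ?wts_ge0 ?powR_ge0.
Qed.

Let iP : mu.-integrable setT (EFin \o (fun x => nsq (G^~ x) `^ (p / 2) + `|u x| `^ p)).
Proof.
apply: integrable_add => //.
exact: (dominated_integrable p0 LG (dominated_nsq T n p)).
Qed.

Let mnpow (q : R) : measurable_fun setT (fun x => nsq (G^~ x) `^ q).
Proof.
by apply: (measurableT_comp (measurable_powR _)) => //; exact: measurable_nsq.
Qed.

Lemma measurable_kernel_factor k j : measurable_fun setT (fun x => kernel_factor k j (G^~ x)).
Proof.
apply: measurable_funM; first exact: measurable_wts.
exact: measurable_funM.
Qed.

Lemma integrable_kernel_factor k j :
  mu.-integrable setT (EFin \o (fun x => kernel_factor k j (G^~ x) * u x)).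
Proof.
apply: integrable_le iP _.
  by apply: measurable_funM => //; exact: measurable_kernel_factor.
move=> x; rewrite normrM; apply: le_trans (npow_young _ (normr_ge0 (u x))).
by rewrite ler_wpM2r// kernel_factor_le1.
Qed.

Let im k : mu.-integrable setT
  (EFin \o (fun x => wts (letters k) (G^~ x) * (npow (G^~ x) * `|u x|))).
Proof.
apply: integrable_le iP _.
  apply: measurable_funM; first exact: measurable_wts.
  apply: measurable_funM; first exact: mnpow.
  exact: measurableT_comp.
move=> x; rewrite ger0_norm ?mulr_ge0 ?wts_ge0 ?powR_ge0//.
apply: le_trans (npow_young _ (normr_ge0 (u x))).
by rewrite ler_piMl ?wts_le1// mulr_ge0 ?powR_ge0.
Qed.

Let iw k : mu.-integrable setT (EFin \o (fun x => wpow p (letters k) (G^~ x))).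
Proof. exact: (dominated_integrable p0 LG (dominated_wpow T p0 pN (letters k))). Qed.

Let iwu k :
  mu.-integrable setT (EFin \o (fun x => wts (letters k) (G^~ x) * `|u x| `^ p)).
Proof.
apply: integrable_le iu _.
  apply: measurable_funM; first exact: measurable_wts.
  apply: (measurableT_comp (measurable_powR _)) => //; exact: measurableT_comp.
move=> x; rewrite ger0_norm ?mulr_ge0 ?wts_ge0 ?powR_ge0//.
by rewrite ler_piMl ?powR_ge0// wts_le1.
Qed.

Let coef_le k z : `|\sum_j z j * kernel_coef k j| <= Num.sqrt (nsq z) * b k.
Proof.
have E : \sum_j z j * kernel_coef k j =
    (\int[mu]_x ((\sum_j z j * kernel_factor k j (G^~ x)) * u x)) / W k.
  pose g j x := z j * (kernel_factor k j (G^~ x) * u x).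
  have ig j : mu.-integrable setT (EFin \o g j)
    by exact: integrable_scale (integrable_kernel_factor k j).
  have -> : \int[mu]_x ((\sum_j z j * kernel_factor k j (G^~ x)) * u x) =
      \int[mu]_x \sum_j g j x.
    apply: eq_Rintegral => x _; rewrite mulr_suml.
    by apply: eq_bigr => j _; rewrite /g mulrA.
  rewrite Rintegral_bigsum// mulr_suml; apply: eq_bigr => j _.
  by rewrite /g (RintegralZl _ measurableT (integrable_kernel_factor k j)) mulrA.
rewrite E normrM (ger0_norm (x := (W k)^-1)) ?invr_ge0// /b mulrA.
rewrite ler_wpM2r ?invr_ge0// -RintegralZl//.
have ig : mu.-integrable setT
   (EFin \o (fun x => (\sum_j z j * kernel_factor k j (G^~ x)) * u x)).
  apply: integrable_le (integrable_scale (Num.sqrt (nsq z)) (im k)) _.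
    apply: measurable_funM => //; apply: measurable_sum => j.
    by apply: measurable_funM => //; exact: measurable_kernel_factor.
  move=> x; rewrite normrM !mulrA ler_wpM2r// -mulrA; exact: kernel_factor_le.
apply: le_trans (le_normr_Rintegral _ _) _ => //.
apply: le_Rintegral => //.
- exact: (integrable_norm ig).
- exact: integrable_scale (im k).
- by move=> x _; rewrite normrM !mulrA ler_wpM2r// -mulrA; exact: kernel_factor_le.
Qed.

(** Second use of Jensen: the tangent line of t^p at b k |G| is integrated against the weight, and
    its linear term drops out because m k = b k W k. *)
Let b_le k : b k `^ p * W k <=
  \int[mu]_x (wts (letters k) (G^~ x) * `|u x| `^ p).
Proof.
have [Wk|Wk] := eqVneq (W k) 0.
  rewrite Wk mulr0 Rintegral_ge0// => x _.
  by rewrite mulr_ge0 ?wts_ge0 ?powR_ge0.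
pose g x := (b k `^ p - p * b k `^ (p - 1) * b k) * wpow p (letters k) (G^~ x).
pose h x := p * b k `^ (p - 1) *
  (wts (letters k) (G^~ x) * (npow (G^~ x) * `|u x|)).
have ig : mu.-integrable setT (EFin \o g) by exact: integrable_scale (iw k).
have ih : mu.-integrable setT (EFin \o h) by exact: integrable_scale (im k).
have -> : b k `^ p * W k = \int[mu]_x (g x + h x).
  rewrite RintegralD// /g /h !RintegralZl//.
  rewrite -/(W k) -/(m k); have -> : m k = b k * W k by rewrite /b divfK.
  ring.
apply: le_Rintegral => //; first exact: integrable_add.
move=> x _; have := nsq_tangent (G^~ x) (b0 k) (normr_ge0 (u x)).
move/(ler_wpM2l (wts_ge0 (letters k) (G^~ x))); apply: le_trans.
by rewrite le_eqVlt; apply/orP; left; apply/eqP; rewrite /g /h /wpow; ring.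
Qed.

Variable F : 'I_n -> T -> R.
Hypothesis LF : Lp_family mu p F.
Hypothesis FG : forall s, \int[mu]_x wpow p s (F^~ x) = \int[mu]_x wpow p s (G^~ x).

(** Jensen over words leaves integrals of [wpow] at F; [FG] moves them to G, where Jensen over T
    applies, and the weights sum to at most 1. *)
Lemma kernel_contraction :
  \int[mu]_x (`|kernel_sum kernel_coef (F^~ x)| `^ p) <= \int[mu]_x (`|u x| `^ p).
Proof.
apply: le_trans (kernel_sum_integral_le p1 pN N0 LF b0 coef_le) _.
under eq_bigr do rewrite FG.
apply: (@le_trans _ _ (\sum_k \int[mu]_x (wts (letters k) (G^~ x) * `|u x| `^ p))).
  by apply: ler_sum => k _; exact: b_le.
rewrite -Rintegral_bigsum//; apply: le_Rintegral => //.
  exact: integrable_bigsum.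
move=> x _; rewrite -mulr_suml ler_piMl ?powR_ge0//.
exact: wts_sum_le1.
Qed.

End contraction.

(** * Approximation of the basis by the operator *)

Section approximation.
Context d (T : measurableType d) (R : realType).
Variables (mu : {measure set T -> \bar R}) (n N : nat) (p : R).
Hypothesis p1 : 1 <= p.
Hypothesis pN : forall m : nat, p / 2 != m%:R.
Hypothesis N0 : (0 < N)%N.
Implicit Types (y z : 'I_n -> R) (k : word n N) (i j : 'I_n).

Let p0 : 0 < p. Proof. exact: lt_le_trans p1. Qed.

(** For u = G i it turns the coefficients into integrals of [line_proj] against [wpow], which take
    the same value at F and G. *)
Lemma kernel_factor_mul k i j y :
  kernel_factor p k j y * y i = line_proj j i y * wpow p (letters k) y.
Proof.
have [y0|y0] := eqVneq (nsq y) 0.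
  by rewrite /kernel_factor (nsq_eq0 i y0) mulr0 /line_proj (nsq_eq0 i y0) mulr0 !mul0r.
rewrite /kernel_factor /line_proj /wpow.
have -> : nsq y `^ ((p - 2) / 2) = nsq y `^ (p / 2) / nsq y.
  rewrite mulrBl divff ?pnatr_eq0// powRB; last by rewrite y0 implybT.
  by rewrite powRr1 ?nsq_ge0.
by ring.
Qed.

Variable F : 'I_n -> T -> R.
Hypothesis LF : Lp_family mu p F.

Let W k := \int[mu]_x wpow p (letters k) (F^~ x).
Let M k i j := \int[mu]_x (line_proj j i (F^~ x) * wpow p (letters k) (F^~ x)).
Let A k i j := M k i j / W k.
Let P := \int[mu]_x nsq (F^~ x) `^ (p / 2).

Let dw k := dominated_wpow T p0 pN (letters k).
Let dpw k i j := dominated_line_proj_wpow T p0 pN j i (letters k).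

Let W0 k : 0 <= W k.
Proof. by apply: Rintegral_ge0 => x _; exact: wpow_ge0. Qed.

Let M_le k i j : `|M k i j| <= W k.
Proof.
apply: le_trans (le_normr_Rintegral _ _) _ => //.
  exact: (dominated_integrable p0 LF (dpw k i j)).
apply: le_Rintegral => //.
- apply: integrable_norm; exact: (dominated_integrable p0 LF (dpw k i j)).
- exact: (dominated_integrable p0 LF (dw k)).
move=> x _; rewrite normrM (ger0_norm (wpow_ge0 _ _ _)).
by rewrite ler_piMl ?wpow_ge0// line_proj_le1.
Qed.

Let A_le1 k i j : `|A k i j| <= 1.
Proof.
rewrite normrM normfV (ger0_norm (W0 k)).
have [->|Wk] := eqVneq (W k) 0; first by rewrite invr0 mulr0.
by rewrite ler_pdivrMr ?mul1r// lt_neqAle eq_sym Wk W0.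
Qed.

Let AW k i j : A k i j * W k = M k i j.
Proof.
have [Wk|Wk] := eqVneq (W k) 0; last by rewrite /A divfK.
have := M_le k i j; rewrite Wk mulr0 normr_le0 => /eqP ->.
by [].
Qed.

Definition wdev c k i j y : R :=
  wpow p (letters k) y * (c - line_proj j i y) ^+ 2.

Lemma dominated_wdev c k i j : dominated T p (wdev c k i j).
Proof.
have d2 : dominated T p
    (fun y => line_proj j i y * (line_proj j i y * wpow p (letters k) y)).
  apply: dominatedM (dpw k i j); first exact: line_proj_le1.
  by move=> H mH; exact: measurable_line_proj.
have := dominatedD (dominatedD (dominatedZ (c ^+ 2) (dw k))
  (dominatedZ (- (2 * c)) (dpw k i j))) d2.
rewrite (_ : (fun y => _) = wdev c k i j)//.
by apply/funext => y; rewrite /wdev; ring.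
Qed.

(* [A k i j] is the mean of [line_proj j i] for the weight [wpow p (letters k)],
   hence it minimizes the quadratic deviation. *)
Let wdev_min c k i j : \int[mu]_x wdev (A k i j) k i j (F^~ x) <=
  \int[mu]_x wdev c k i j (F^~ x).
Proof.
have I c' := dominated_integrable p0 LF (dominated_wdev c' k i j).
have Iw := dominated_integrable p0 LF (dw k).
have Im := dominated_integrable p0 LF (dpw k i j).
rewrite -subr_ge0 -RintegralB //; try exact: I.
pose g x := (c ^+ 2 - A k i j ^+ 2) * wpow p (letters k) (F^~ x).
pose h x := (- 2 * (c - A k i j)) *
  (line_proj j i (F^~ x) * wpow p (letters k) (F^~ x)).
have ig : mu.-integrable setT (EFin \o g) by exact: integrable_scale Iw.
have ih : mu.-integrable setT (EFin \o h) by exact: integrable_scale Im.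
rewrite (_ : \int[mu]_x _ = \int[mu]_x (g x + h x)); last first.
  by apply: eq_Rintegral => x _; rewrite /wdev /g /h; ring.
rewrite RintegralD// /g /h !RintegralZl// -/(W k) -/(M k i j) -AW.
rewrite (_ : _ + _ = W k * (c - A k i j) ^+ 2); last by ring.
by rewrite mulr_ge0 ?sqr_ge0.
Qed.

Definition kernel_error i y : R := kernel_sum (fun k j => A k i j) y - y i.

Let dev i y := \sum_j \sum_k wts (letters k) y * `|A k i j - line_proj j i y|.

Let dev_ge0 i y : 0 <= dev i y.
Proof. by do 2 (apply: sumr_ge0 => ? _); rewrite mulr_ge0 ?wts_ge0. Qed.

Let dev_le i y : dev i y <= n%:R *+ 2.
Proof.
apply: (@le_trans _ _ (\sum_(j < n) 2)); last first.
  by rewrite sumr_const card_ord -mulrnA mulnC mulrnA.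
apply: ler_sum => j _.
apply: (@le_trans _ _ (\sum_(k : word n N) wts (letters k) y * 2)).
  apply: ler_sum => k _; rewrite ler_wpM2l ?wts_ge0//.
  by apply: le_trans (ler_normB _ _) _; rewrite (lerD (A_le1 _ _ _))// line_proj_le1.
by rewrite -mulr_suml ler_piMl// wts_sum_le1.
Qed.

Lemma kernel_error_le i y : `|kernel_error i y| <= Num.sqrt (nsq y) * dev i y.
Proof.
have [y0|y0] := eqVneq (nsq y) 0.
  rewrite /kernel_error (nsq_eq0 i y0) /kernel_sum big1 ?subrr ?normr0.
    by rewrite mulr_ge0 ?sqrtr_ge0.
  by move=> k _; rewrite wts0 ?mul0r.
(* y_i is the sum over j of y_j [line_proj j i y], and the weights of the words sum to 1, so both
   terms become averages over words. *)
have -> : kernel_error i y =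
    \sum_j y j * \sum_k wts (letters k) y * (A k i j - line_proj j i y).
  transitivity (kernel_sum (fun k j => A k i j) y -
      \sum_j y j * line_proj j i y).
    congr (_ - _); rewrite -[LHS](sum_line_proj i).
    by apply: eq_bigr => j _; rewrite /line_proj [y i * _]mulrC.
  rewrite /kernel_sum.
  under eq_bigr do rewrite mulr_sumr.
  rewrite exchange_big/= -sumrB; apply: eq_bigr => j _.
  under [in RHS]eq_bigr do rewrite mulrBr.
  rewrite sumrB -mulr_suml wts_sum// mul1r mulrBr; congr (_ - _).
  by rewrite mulr_sumr; apply: eq_bigr => k _; rewrite mulrCA.
apply: le_trans (ler_norm_sum _ _ _) _; rewrite /dev mulr_sumr ler_sum// => j _.
rewrite normrM ler_pM//.
  rewrite -sqrtr_sqr ler_wsqrtr// /nsq (bigD1 j)//= lerDl.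
  by apply: sumr_ge0 => l _; exact: sqr_ge0.
apply: le_trans (ler_norm_sum _ _ _) _; rewrite ler_sum// => k _.
by rewrite normrM (ger0_norm (wts_ge0 _ _)).
Qed.

Let C := (n%:R *+ 2) `^ (p - 1).

(** Since [dev] is at most 2 n, its p-th power is at most C = (2 n)^(p - 1) times [dev]. *)
Lemma kernel_error_powR_le i y : `|kernel_error i y| `^ p <=
  C * (nsq y `^ (p / 2) * dev i y).
Proof.
apply: (@le_trans _ _ ((Num.sqrt (nsq y) * dev i y) `^ p)).
  by apply: ge0_ler_powR; rewrite ?nnegrE ?(ltW p0) ?mulr_ge0 ?sqrtr_ge0 ?kernel_error_le.
rewrite powRM ?sqrtr_ge0// sqrt_nsq_powR mulrCA ler_wpM2l ?powR_ge0//.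
rewrite -mulr_powRB1// mulrC ler_wpM2r//.
by apply: ge0_ler_powR; rewrite ?nnegrE ?subr_ge0 ?dev_le// mulrn_wge0.
Qed.

(** The inequality |q| <= c + q^2 / c passes from deviations to squared deviations, which the
    variance bound controls. *)
Lemma kernel_error_dev_le (c : R) i y : 0 < c -> `|kernel_error i y| `^ p <=
  C * \sum_j \sum_k (c * wpow p (letters k) y + c^-1 * wdev (A k i j) k i j y).
Proof.
move=> c0; apply: le_trans (kernel_error_powR_le i y) _.
rewrite ler_wpM2l ?powR_ge0// mulr_sumr ler_sum// => j _.
rewrite mulr_sumr ler_sum// => k _.
rewrite mulrCA mulrA -/(wpow p (letters k) y) /wdev.
set q := A k i j - _.
have H : `|q| <= c + c^-1 * q ^+ 2.
  rewrite -(ler_pM2l c0) mulrDr mulrA mulfV ?gt_eqF// mul1r -(real_normK (num_real q)).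
  by have := sqr_ge0 (`|q| - c); have := normr_ge0 q; nra.
apply: le_trans (ler_wpM2l (wpow_ge0 _ _ _) H) _.
by rewrite le_eqVlt; apply/orP; left; apply/eqP; ring.
Qed.

Lemma dominated_kernel_error i : dominated T p (fun y => `|kernel_error i y| `^ p).
Proof.
split.
  exists (C * (n%:R *+ 2)) => y; rewrite ger0_norm ?powR_ge0//.
  apply: le_trans (kernel_error_powR_le i y) _; rewrite -mulrA ler_wpM2l ?powR_ge0//.
  by rewrite mulrC ler_wpM2r ?powR_ge0.
move=> H mH; apply: (measurableT_comp (measurable_powR _)) => //.
apply: measurableT_comp => //; apply: measurable_funB => //.
exact: measurable_kernel_sum.
Qed.

Let P0 : 0 <= P.
Proof. by apply: Rintegral_ge0 => x _; exact: powR_ge0. Qed.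

(** By [wdev_min] the coefficient A may be replaced by [mean_score], which depends on the word alone
    and whose squared deviation [wts_variance] bounds at each point. *)
Lemma kernel_error_integral_le (c : R) i : 0 < c ->
  \int[mu]_x (`|kernel_error i (F^~ x)| `^ p) <=
  C * n%:R * (c + c^-1 * (n%:R ^+ 2 / N%:R)) * P.
Proof.
move=> c0.
have iw k := dominated_integrable p0 LF (dw k).
have iwd k j c' := dominated_integrable p0 LF (dominated_wdev c' k i j).
have iP := dominated_integrable p0 LF (dominated_nsq T n p).
pose g j k x := c * wpow p (letters k) (F^~ x) +
   c^-1 * wdev (A k i j) k i j (F^~ x).
have ig j k : mu.-integrable setT (EFin \o g j k).
  exact: (integrable_add (integrable_scale c (iw k))
      (integrable_scale c^-1 (iwd k j _))).
have igs j : mu.-integrable setT (EFin \o (fun x => \sum_k g j k x)).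
  exact: integrable_bigsum.
have igss : mu.-integrable setT (EFin \o (fun x => \sum_j \sum_k g j k x)).
  exact: integrable_bigsum.
apply: (@le_trans _ _ (\int[mu]_x (C * \sum_j \sum_k g j k x))).
  apply: le_Rintegral => //.
  - exact: (dominated_integrable p0 LF (dominated_kernel_error i)).
  - exact: integrable_scale.
  - by move=> x _; exact: kernel_error_dev_le.
rewrite RintegralZl// -[leRHS]mulrA -[leRHS]mulrA ler_wpM2l ?powR_ge0//.
rewrite Rintegral_bigsum//.
apply: (@le_trans _ _ (\sum_(j < n) ((c + c^-1 * (n%:R ^+ 2 / N%:R)) * P))); last first.
  by rewrite sumr_const card_ord mulr_natl.
apply: ler_sum => j _.
pose h x := \sum_k (c * wpow p (letters k) (F^~ x) +
  c^-1 * wdev (mean_score R j i k) k i j (F^~ x)).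
rewrite Rintegral_bigsum//.
apply: (@le_trans _ _ (\int[mu]_x h x)).
  rewrite Rintegral_bigsum; last first.
    move=> k; exact: (integrable_add (integrable_scale c (iw k))
      (integrable_scale c^-1 (iwd k j _))).
  apply: ler_sum => k _.
  have E c' : \int[mu]_x (c * wpow p (letters k) (F^~ x) +
      c^-1 * wdev c' k i j (F^~ x)) =
      c * W k + c^-1 * \int[mu]_x wdev c' k i j (F^~ x).
    rewrite (RintegralD measurableT (integrable_scale c (iw k))
      (integrable_scale c^-1 (iwd k j c'))).
    by rewrite (RintegralZl _ measurableT (iw k)) (RintegralZl _ measurableT (iwd k j c')).
  rewrite /g !E lerD2l ler_wpM2l ?invr_ge0 ?(ltW c0)//.
rewrite -RintegralZl//; apply: le_Rintegral => //.
- apply: integrable_bigsum => k.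
  exact: (integrable_add (integrable_scale c (iw k))
      (integrable_scale c^-1 (iwd k j _))).
- exact: integrable_scale.
move=> x _; rewrite /h big_split/= -!mulr_sumr.
have [y0|y0] := eqVneq (nsq (F^~ x)) 0.
  rewrite !big1 ?mulr0 ?addr0 ?mulr_ge0 ?powR_ge0//.
  - by rewrite addr_ge0 ?mulr_ge0 ?invr_ge0 ?exprn_ge0// ltW.
  - by move=> k _; rewrite /wdev /wpow wts0 ?mul0r.
  - by move=> k _; rewrite /wpow wts0 ?mul0r.
rewrite mulrDl lerD//.
  by rewrite ler_wpM2l ?(ltW c0)// -mulr_suml wts_sum// mul1r.
rewrite -mulrA ler_wpM2l ?invr_ge0 ?(ltW c0)//.
have := wts_variance j i N0 y0 => /(ler_wpM2r (powR_ge0 (nsq (F^~ x)) (p / 2))).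
apply: le_trans; rewrite mulr_suml le_eqVlt; apply/orP; left; apply/eqP.
by apply: eq_bigr => k _; rewrite /wdev /wpow; ring.
Qed.

End approximation.

(** * The operator on L_p *)

Section Lspace_extra.
Context d (T : measurableType d) (R : realType).
Variables (mu : {measure set T -> \bar R}) (p : R) (p1 : (1 <= p%:E)%E).
Local Notation L := (LspaceType mu p1).
Local Notation ty := (LfunType mu p1).

Let p1' : 1 <= p. Proof. by rewrite -lee_fin. Qed.
Let p0 : 0 < p. Proof. exact: lt_le_trans p1'. Qed.

Lemma Lspace_classZD (a : R) (f g : ty) :
  Lspace_class (a *: f + g) = a *: Lspace_class f + Lspace_class g.
Proof. by rewrite Lspace_class_scale Lspace_class_add. Qed.

Lemma Lspace_class_sum (I : Type) (s : seq I) (f : I -> ty) :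
  Lspace_class (\sum_(i <- s) f i) = \sum_(i <- s) Lspace_class (f i).
Proof.
elim: s => [|i s IH]; first by rewrite !big_nil.
by rewrite !big_cons -IH Lspace_class_add.
Qed.

Lemma Lfun_sumE (I : Type) (s : seq I) (f : I -> ty) x :
  (\sum_(i <- s) f i : ty) x = \sum_(i <- s) f i x.
Proof. by elim: s => [|i s IH]; rewrite ?big_nil// !big_cons -IH. Qed.

Lemma LfunType_integrable (f : ty) :
  mu.-integrable setT (EFin \o (fun x => `|f x| `^ p)).
Proof. exact: (Lfun_integrable p1' (LfunP f)). Qed.

Lemma Lspace_norm_powR (f : ty) :
  `|Lspace_class f| `^ p = \int[mu]_x (`|f x| `^ p).
Proof.
rewrite Lspace_normE -fine_poweR powR_Lnorm ?gt_eqF//.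
Qed.

Lemma Lspace_norm_powRE (f : ty) :
  (`|Lspace_class f| `^ p)%:E = (\int[mu]_x (`|f x| `^ p)%:E)%E.
Proof.
rewrite Lspace_norm_powR /Rintegral fineK//.
exact: (integrable_fin_num measurableT (LfunType_integrable f)).
Qed.

Lemma Lfun_integrable_powR (f : T -> R) : measurable_fun setT f ->
  mu.-integrable setT (EFin \o (fun x => `|f x| `^ p)) -> f \in Lfun mu p%:E.
Proof.
move=> mf /integrableP[_ fy]; apply/andP; split; first by rewrite inE.
rewrite inE /= /finite_norm unlock; apply: poweR_lty.
apply: le_lt_trans fy; rewrite le_eqVlt; apply/orP; left; apply/eqP.
by apply: eq_integral => x _; rewrite /= (ger0_norm (powR_ge0 _ _)).
Qed.

Lemma Lfun_bounded (f : T -> R) (g : ty) : measurable_fun setT f ->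
  (forall x, `|f x| <= `|g x|) -> f \in Lfun mu p%:E.
Proof.
move=> mf fg; apply: Lfun_integrable_powR => //.
apply: integrable_le (LfunType_integrable g) _.
  by apply: (measurableT_comp (measurable_powR _)) => //; exact: measurableT_comp.
move=> x; rewrite ger0_norm ?powR_ge0//.
by apply: ge0_ler_powR => //; exact: ltW.
Qed.

Lemma ae_eq_Rintegral (f g : T -> R) : measurable_fun setT f ->
  measurable_fun setT g -> f = g %[ae mu] ->
  \int[mu]_x f x = \int[mu]_x g x.
Proof.
move=> mf mg fg; rewrite /Rintegral; congr fine.
apply: ae_eq_integral => //; [exact/measurable_EFinP|exact/measurable_EFinP|].
by apply: filterS fg => x /= /[apply] ->.
Qed.

Lemma Lspace_reprZD (a : R) (u v : L) :
  (Lspace_repr (a *: u + v) : T -> R) =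
  (fun x => a * Lspace_repr u x + Lspace_repr v x) %[ae mu].
Proof.
have E : a *: u + v = Lspace_class (a *: Lspace_repr u + Lspace_repr v).
  by rewrite Lspace_classZD !Lspace_reprK.
apply: filterS (Lspace_classP (a *: Lspace_repr u + Lspace_repr v)) => x H I.
by rewrite E H.
Qed.

Lemma Lp_family_repr n (e : 'I_n -> L) :
  Lp_family mu p (fun i => Lspace_repr (e i)).
Proof.
split=> i; first exact: measurable_funPT.
have /integrableP[_] := LfunType_integrable (Lspace_repr (e i)).
by under eq_integral do rewrite /= (ger0_norm (powR_ge0 _ _)).
Qed.

Lemma Lspace_norm_comb n (e : 'I_n -> L) (a : 'I_n -> R) :
  (`|\sum_i a i *: e i| `^ p)%:E =
  (\int[mu]_x (`|dot a (fun i => Lspace_repr (e i) x)| `^ p)%:E)%E.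
Proof.
have -> : \sum_i a i *: e i = Lspace_class (\sum_i a i *: Lspace_repr (e i)).
  rewrite Lspace_class_sum; apply: eq_bigr => i _.
  by rewrite -Lspace_class_scale Lspace_reprK.
by rewrite Lspace_norm_powRE; apply: eq_integral => x _; rewrite Lfun_sumE.
Qed.

Lemma powR_le_inv (a b : R) : 0 <= a -> 0 <= b -> a `^ p <= b `^ p -> a <= b.
Proof.
move=> a0 b0; rewrite leNgt [in X in _ -> X]leNgt; apply: contra => ba.
by apply: gt0_ltr_powR => //; rewrite nnegrE.
Qed.

End Lspace_extra.

Section kernel_operator.
Context d (T : measurableType d) (R : realType).
Variables (mu : {measure set T -> \bar R}) (p : R) (p1 : (1 <= p%:E)%E).
Local Notation L := (LspaceType mu p1).
Local Notation ty := (LfunType mu p1).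
Hypothesis pN : forall m : nat, p / 2 != m%:R.
Variables (n N : nat) (e f : 'I_n -> L).
Hypothesis N0 : (0 < N)%N.
Hypothesis sf : sigma_finite setT mu.
Hypothesis ef : forall c : 'I_n -> R, `|\sum_i c i *: e i| = `|\sum_i c i *: f i|.

Let p1' : 1 <= p. Proof. by rewrite -lee_fin. Qed.
Let p0 : 0 < p. Proof. exact: lt_le_trans p1'. Qed.

Let F i : T -> R := Lspace_repr (e i).
Let G i : T -> R := Lspace_repr (f i).
Let LF : Lp_family mu p F := Lp_family_repr e.
Let LG : Lp_family mu p G := Lp_family_repr f.

Let FG (a : 'I_n -> R) :
  (\int[mu]_x (`|dot a (F^~ x)| `^ p)%:E = \int[mu]_x (`|dot a (G^~ x)| `^ p)%:E)%E.
Proof. by rewrite -(Lspace_norm_comb e) -(Lspace_norm_comb f) ef. Qed.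

Let wpow_eq s : \int[mu]_x wpow p s (F^~ x) = \int[mu]_x wpow p s (G^~ x).
Proof.
under eq_Rintegral do rewrite (wpow_mom p0 pN).
under [RHS]eq_Rintegral do rewrite (wpow_mom p0 pN).
rewrite (Rintegral_dominatedZ p0 _ LF (dominated_mom pN T _ _)).
rewrite (Rintegral_dominatedZ p0 _ LG (dominated_mom pN T _ _)).
by rewrite (mom_integral_eq p0 sf p1' pN LF LG FG).
Qed.

Let line_proj_wpow_eq a b s : \int[mu]_x (line_proj a b (F^~ x) * wpow p s (F^~ x)) =
  \int[mu]_x (line_proj a b (G^~ x) * wpow p s (G^~ x)).
Proof.
have dw (s' : seq (letter n)) := dominated_wpow T p0 pN s'.
have E H : Lp_family mu p H ->
    \int[mu]_x (line_proj a b (H^~ x) * wpow p s (H^~ x)) =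
    n%:R * (\int[mu]_x wpow p ((a, b, false) :: s) (H^~ x) -
            \int[mu]_x wpow p ((a, b, true) :: s) (H^~ x)).
  move=> LH; under eq_Rintegral do rewrite line_proj_wpow.
  rewrite (Rintegral_dominatedZ p0 _ LH (dominatedB (dw _) (dw _))).
  by rewrite (Rintegral_dominatedB p0 LH (dw _) (dw _)).
by rewrite (E _ LF) (E _ LG) !wpow_eq.
Qed.

Let basis_fun_Lfun (k : word n N) j :
  (fun x => wts (letters k) (F^~ x) * F j x) \in Lfun mu p%:E.
Proof.
apply: (@Lfun_bounded _ _ _ _ _ p1 _ (Lspace_repr (e j))).
  apply: measurable_funM; last exact: LF.1.
  by apply: measurable_wts; exact: LF.1.
by move=> x; rewrite normrM (ger0_norm (wts_ge0 _ _)) ler_piMl// wts_le1.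
Qed.

Let basis_fun k j : ty := Lfun_Sub p1 (basis_fun_Lfun k j).

Let co (u : L) (k : word n N) j := kernel_coef mu p G (Lspace_repr u) k j.

Let kfun (u : L) : ty := \sum_k \sum_j co u k j *: basis_fun k j.

Definition kernel_op (u : L) : L := Lspace_class (kfun u).

Let kfunE u x : kfun u x = kernel_sum (co u) (F^~ x).
Proof.
rewrite Lfun_sumE /kernel_sum; apply: eq_bigr => k _.
rewrite Lfun_sumE mulr_sumr; apply: eq_bigr => j _.
by rewrite mulrA mulrC.
Qed.

Let mrepr (u : L) : measurable_fun setT (Lspace_repr u : T -> R).
Proof. exact: measurable_funPT. Qed.

Let co_linear a u v k j : co (a *: u + v) k j = a * co u k j + co v k j.
Proof.
have mpsi (w : T -> R) : measurable_fun setT w ->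
    measurable_fun setT (fun x => kernel_factor p k j (G^~ x) * w x).
  by move=> mw; apply: measurable_funM => //; exact: (measurable_kernel_factor LG).
have ip w := integrable_kernel_factor p1' LG (mrepr w) (LfunType_integrable (Lspace_repr w)) k j.
rewrite /co /kernel_coef mulrA -mulrDl; congr (_ / _).
rewrite -(RintegralZl _ measurableT (ip u)).
rewrite -(RintegralD measurableT (integrable_scale a (ip u)) (ip v)).
(* Representatives are linear only almost everywhere, which suffices under the integral. *)
apply: ae_eq_Rintegral; first exact: mpsi.
  apply: measurable_funD; last exact: mpsi.
  by apply: measurable_funM => //; exact: mpsi.
apply: filterS (Lspace_reprZD a u v) => x /= H _.
by rewrite (H I); ring.
Qed.

Lemma kernel_op_linear : linear kernel_op.
Proof.
move=> a u v; rewrite -Lspace_classZD; congr Lspace_class; rewrite /kfun.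
rewrite scaler_sumr -big_split/=; apply: eq_bigr => k _.
rewrite scaler_sumr -big_split/=; apply: eq_bigr => j _.
by rewrite co_linear scalerDl scalerA.
Qed.

Lemma kernel_op_contraction u : `|kernel_op u| <= `|u|.
Proof.
apply: (powR_le_inv p1) => //; rewrite -[in leRHS](Lspace_reprK u).
rewrite !Lspace_norm_powR.
under eq_Rintegral do rewrite kfunE.
exact: (kernel_contraction p1' pN N0 LG (mrepr u) (LfunType_integrable _) LF wpow_eq).
Qed.

Lemma kernel_op_error i :
  `|kernel_op (f i) - e i| `^ p = \int[mu]_x (`|kernel_error mu N p F i (F^~ x)| `^ p).
Proof.
have -> : kernel_op (f i) - e i =
    Lspace_class (kfun (f i) - Lspace_repr (e i)).
  rewrite -scaleN1r -[in LHS](Lspace_reprK (e i)) addrC -Lspace_classZD.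
  by rewrite scaleN1r addrC.
(* At u = f i the integrals over G may be replaced by the same integrals over F, so that
   [kernel_error] involves F alone. *)
have coE k j : co (f i) k j =
    (\int[mu]_x (line_proj j i (F^~ x) * wpow p (letters k) (F^~ x))) /
    (\int[mu]_x wpow p (letters k) (F^~ x)).
  rewrite (line_proj_wpow_eq j i (letters k)) (wpow_eq (letters k)).
  congr (_ / _); apply: eq_Rintegral => z _; exact: kernel_factor_mul.
rewrite Lspace_norm_powR; apply: eq_Rintegral => x _; congr (`|_| `^ _).
transitivity (kfun (f i) x - F i x) => //; rewrite kfunE.
rewrite /kernel_error; move: (F i x) => Fix; apply: (congr1 (fun z => z - Fix)).
apply: eq_bigr => k _; apply: (congr1 (fun z => _ * z)).
by apply: eq_bigr => j _; rewrite coE.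
Qed.

End kernel_operator.

Section approx_contraction.
Context d (T : measurableType d) (R : realType).
Variables (mu : {measure set T -> \bar R}) (p : R) (p1 : (1 <= p%:E)%E).
Local Notation L := (LspaceType mu p1).

Lemma approx_contraction n (e f : 'I_n -> L) (r : R) :
  (forall m : nat, p / 2 != m%:R) -> sigma_finite setT mu ->
  (forall c : 'I_n -> R, `|\sum_i c i *: e i| = `|\sum_i c i *: f i|) ->
  0 < r ->
  exists V : L -> L, [/\ linear V, forall u, `|V u| <= `|u| &
    forall i, `|V (f i) - e i| <= r].
Proof.
move=> pN sf ef r0.
have p1' : 1 <= p by rewrite -lee_fin.
have p0 : 0 < p by exact: lt_le_trans p1'.
pose F i : T -> R := Lspace_repr (e i).
have LF : Lp_family mu p F := Lp_family_repr e.
(* The factor of c + n^2 / (c N) in [kernel_error_integral_le]. *)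
pose K := (n%:R *+ 2) `^ (p - 1) * n%:R * \int[mu]_x nsq (F^~ x) `^ (p / 2).
have K0 : 0 <= K.
  rewrite !mulr_ge0 ?powR_ge0// Rintegral_ge0// => x _; exact: powR_ge0.
pose s := r `^ p; have s0 : 0 < s by exact: powR_gt0.
(* This gives K (c + c) <= r^p; N is then taken so large that n^2 / (c N) <= c. *)
pose c := s / (2 * (K + 1)).
have c0 : 0 < c by rewrite divr_gt0// mulr_gt0// ltr_wpDl.
pose N := (Num.trunc (n%:R ^+ 2 / c ^+ 2)).+1.
have N0 : (0 < N)%N by [].
have NR : 0 < N%:R :> R by rewrite ltr0n.
have cN : c^-1 * (n%:R ^+ 2 / N%:R) <= c.
  have : n%:R ^+ 2 / c ^+ 2 <= N%:R by apply: ltW; exact: truncnS_gt.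
  rewrite ler_pdivrMr ?exprn_gt0// => H.
  rewrite mulrC ler_pdivrMr// ler_pdivrMr//.
  by apply: le_trans H _; rewrite expr2 mulrC.
exists (kernel_op N e f); split.
- exact: kernel_op_linear.
- exact: kernel_op_contraction.
move=> i; apply: (powR_le_inv p1) => //; first exact: ltW.
rewrite kernel_op_error// -/F; apply: le_trans (kernel_error_integral_le p1' pN N0 LF i c0) _.
rewrite mulrAC -/K -/s; apply: (@le_trans _ _ (K * (c + c))).
  by rewrite ler_wpM2l// lerD2l.
rewrite /c; set q := _ / _.
have qE : q * (2 * (K + 1)) = s by rewrite /q divfK// gt_eqF// mulr_gt0// ltr_wpDl.
have q0 : 0 < q by exact: c0.
by rewrite -qE; nra.
Qed.

End approx_contraction.

(** * Projections *)

Section finite_dim.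
Context (R : realType) (X : normedModType R) (n : nat).
Variable e : 'I_n -> X.
Hypothesis e_free : forall c : 'I_n -> R, \sum_i c i *: e i = 0 -> forall i, c i = 0.

(** On the compact unit sphere of coordinates the norm of the combination attains a minimum,
    positive by freeness; K is its inverse. *)
Lemma free_coord_bounded : exists2 K : R, 0 <= K &
  forall (c : 'I_n -> R) i, `|c i| <= K * `|\sum_j c j *: e j|.
Proof.
(* For n = 0 the sphere is empty and has no minimum. *)
case: n e e_free => [|m] b b_free; first by exists 0 => // c [].
pose phi (v : 'rV[R]_m.+1) : R := `|\sum_i v ord0 i *: b i|.
have cs (r : seq 'I_m.+1) :
    continuous (fun w : 'rV[R]_m.+1 => \sum_(i <- r) w ord0 i *: b i).
  elim: r => [|i r IH].
    rewrite (_ : (fun w => _) = cst 0); first exact: cst_continuous.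
    by apply/funext => w; rewrite big_nil.
  rewrite (_ : (fun w => _) = (fun w : 'rV[R]_m.+1 =>
    w ord0 i *: b i + \sum_(i <- r) w ord0 i *: b i)); last first.
    by apply/funext => w; rewrite big_cons.
  move=> v; apply: (@continuousD _ _ _ (fun w : 'rV[R]_m.+1 => w ord0 i *: b i)
    (fun w : 'rV[R]_m.+1 => \sum_(i <- r) w ord0 i *: b i)); last exact: IH.
  by apply: continuousZr_tmp; exact: coord_continuous.
have cphi : continuous phi.
  move=> v; apply: continuous_comp; last exact: norm_continuous.
  exact: cs.
pose S := [set v : 'rV[R]_m.+1 | `|v| = 1].
have cS : compact S.
  apply: bounded_closed_compact.
    by exists 1; split=> // x x1 v /= ->; exact: ltW.
  rewrite (_ : S = (fun v => `|v|) @^-1` [set 1])//.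
  apply: closed_comp; last exact: closed_eq.
  by move=> v _; exact: norm_continuous.
have S0 : S !=set0.
  have u0 : (const_mx 1 : 'rV[R]_m.+1) != 0.
    by apply/eqP => /rowP/(_ ord0)/eqP; rewrite !mxE oner_eq0.
  exists (`|const_mx 1 : 'rV[R]_m.+1|^-1 *: const_mx 1) => /=.
  by rewrite /S /= normrZ gtr0_norm ?invr_gt0 ?normr_gt0// mulVf// normr_eq0.
have [v Sv vmin] := EVT_min_rV S0 cS (continuous_subspaceT cphi).
have phi0 : 0 < phi v.
  rewrite lt_neqAle normr_ge0 andbT eq_sym; apply/negP => /eqP/normr0_eq0 /b_free v0.
  move: Sv; rewrite inE /S/= (_ : v = 0) ?normr0; first by move/eqP; rewrite eq_sym oner_eq0.
  by apply/rowP => i; rewrite v0 mxE.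
exists (phi v)^-1; first by rewrite invr_ge0 ltW.
move=> c i; rewrite mulrC ler_pdivlMr//.
pose w := \row_j c j.
have -> : \sum_j c j *: b j = \sum_j w ord0 j *: b j.
  by apply: eq_bigr => j _; rewrite mxE.
have cw : `|c i| <= `|w|.
  rewrite [leRHS]/Num.Def.normr /= mx_normrE; apply/bigmax_geP; right => /=.
  by exists (ord0, i) => //=; rewrite mxE.
apply: (@le_trans _ _ (`|w| * phi v)); first by rewrite ler_wpM2r ?(ltW phi0).
have [w0|w0] := eqVneq w 0; first by rewrite w0 normr0 mul0r.
have w1 : 0 < `|w| by rewrite normr_gt0.
have := vmin (`|w|^-1 *: w).
have -> : phi (`|w|^-1 *: w) = `|w|^-1 * `|\sum_j w ord0 j *: b j|.
  rewrite /phi; under eq_bigr do rewrite mxE -scalerA.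
  by rewrite -scaler_sumr normrZ gtr0_norm// invr_gt0.
rewrite ler_pdivlMl//; apply.
by rewrite inE /S/= normrZ gtr0_norm ?invr_gt0// mulVf// gt_eqF.
Qed.

End finite_dim.

Section operator_norm.
Context (R : realType) (X : normedModType R).
Implicit Types P : {linear X -> X}.

Lemma linear_bounded_near P (M : R) : (forall x, `|P x| <= M * `|x|) ->
  bounded_near P (nbhs (0 : X)).
Proof.
move=> PM; apply/linear_boundedP; near=> r => x.
by apply: le_trans (PM x) _; rewrite ler_wpM2r.
Unshelve. all: by end_near. Qed.

Lemma operator_norm_le P (M : R) : (forall x, `|P x| <= M * `|x|) -> 0 <= M ->
  operator_norm P <= M.
Proof.
move=> PM M0; apply: ge_sup.
  by exists `|P 0|; exists 0 => //=; rewrite normr0.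
move=> _ [x /= x1 <-]; apply: le_trans (PM x) _.
by rewrite ler_piMr.
Qed.

Lemma operator_norm_ub P x : bounded_near P (nbhs (0 : X)) -> `|x| <= 1 ->
  `|P x| <= operator_norm P.
Proof.
move=> /linear_boundedP/pinfty_ex_gt0[M M0 PM] x1; apply: ub_le_sup.
  exists M => _ [y /= y1 <-]; apply: le_trans (PM y) _.
  by rewrite ler_piMr// ltW.
by exists x.
Qed.

Lemma operator_norm_ge0 P : bounded_near P (nbhs (0 : X)) -> 0 <= operator_norm P.
Proof.
move=> bP; have := @operator_norm_ub P 0 bP.
by rewrite linear0 normr0; apply.
Qed.

Lemma le_operator_norm P x : bounded_near P (nbhs (0 : X)) ->
  `|P x| <= operator_norm P * `|x|.
Proof.
move=> bP.
have [->|x0] := eqVneq x 0; first by rewrite linear0 normr0 mulr0.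
have x1 : 0 < `|x| by rewrite normr_gt0.
have -> : P x = `|x| *: P (`|x|^-1 *: x).
  by rewrite -linearZ/= scalerA divff ?gt_eqF// scale1r.
rewrite normrZ normr_id mulrC ler_wpM2r//; apply: operator_norm_ub => //.
by rewrite normrZ gtr0_norm ?invr_gt0// mulVf// gt_eqF.
Qed.

End operator_norm.

Definition span_of (R : realType) (X : normedModType R) n (e : 'I_n -> X) : set X :=
  [set x | exists c : 'I_n -> R, x = \sum_i c i *: e i].

(** * Transfer of a projection along a near-inverse of the isometry *)

Section transfer.
Context (R : realType) (X : normedModType R) (n : nat).
Variables e f : 'I_n -> X.
Hypothesis e_free : forall c : 'I_n -> R, \sum_i c i *: e i = 0 -> forall i, c i = 0.
Hypothesis ef : forall c : 'I_n -> R, `|\sum_i c i *: e i| = `|\sum_i c i *: f i|.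
Hypothesis approx : forall r : R, 0 < r -> exists V : X -> X,
  [/\ linear V, forall u, `|V u| <= `|u| & forall i, `|V (f i) - e i| <= r].

Variable P : {linear X -> X}.
Hypothesis P_proj : is_bounded_projection_onto (span_of e) P.

Let bP : bounded_near P (nbhs (0 : X)). Proof. by case: P_proj. Qed.

Let comb (v : 'rV[R]_n) (b : 'I_n -> X) : X := \sum_i v ord0 i *: b i.

Let combD (a : R) u v b : comb (a *: u + v) b = a *: comb u b + comb v b.
Proof.
rewrite /comb scaler_sumr -big_split/=; apply: eq_bigr => i _.
by rewrite !mxE scalerDl scalerA.
Qed.

Let comb_inj : injective (comb^~ e).
Proof.
move=> u v uv; apply/rowP => i; apply/eqP; rewrite -subr_eq0; apply/eqP.
apply: (e_free (c := fun i => u ord0 i - v ord0 i)).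
under eq_bigr do rewrite scalerBl.
by rewrite sumrB -/(comb u e) uv subrr.
Qed.

Let Pe i : P (e i) = e i.
Proof.
case: P_proj => _ PP rP.
have : span_of e (e i).
  exists (fun j => (j == i)%:R); rewrite (bigD1 i)//= eqxx scale1r big1 ?addr0//.
  by move=> j /negbTE ->; rewrite scale0r.
by rewrite -rP => -[x _ <-]; rewrite PP.
Qed.

(** In the bases f and e, the restriction of P V to the span of f has a matrix m close to the
    identity. Q takes the coordinates of P V x, multiplies them by the inverse of m and reads the
    result in the basis f. *)
Lemma projection_transfer (h : R) : 0 < h < 1 -> exists Q : {linear X -> X},
  is_bounded_projection_onto (span_of f) Q /\
  operator_norm Q <= operator_norm P / (1 - h).
Proof.
move=> /andP[h0 h1].
have [K K0 HK] := free_coord_bounded e_free.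
have p0 := operator_norm_ge0 bP.
(* Makes n K |P| r at most h; the added 1 keeps the denominator positive. *)
pose r := h / (n%:R * K * operator_norm P + 1).
have den : 0 < n%:R * K * operator_norm P + 1 by rewrite ltr_wpDl// !mulr_ge0.
have r0 : 0 < r by rewrite divr_gt0.
have [V [V_lin V_le V_ef]] := approx r0.
have cP x : {v : 'rV[R]_n | P x = comb v e}.
  apply: cid; case: P_proj => _ _ rP.
  have : span_of e (P x) by rewrite -rP; exists x.
  move=> [c ->]; exists (\row_i c i).
  by apply: eq_bigr => i _; rewrite mxE.
pose xi x := sval (cP x); have xiE x : P x = comb (xi x) e by exact: svalP (cP x).
have xi_lin a x y : xi (a *: x + y) = a *: xi x + xi y.
  by apply: comb_inj; rewrite -xiE combD -!xiE linearD linearZ.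
pose VL : {linear X -> X} := HB.pack V (GRing.isLinear.Build R X X *:%R V V_lin).
pose m : 'M[R]_n := \matrix_i xi (V (f i)).
have VS v : V (comb v f) = \sum_i v ord0 i *: V (f i).
  rewrite -[V]/(VL : X -> X) /comb linear_sum; apply: eq_bigr => i _.
  exact: linearZ.
have mE v : comb (v *m m) e = P (V (comb v f)).
  rewrite VS linear_sum [LHS]/comb.
  have -> : \sum_i (v *m m) ord0 i *: e i =
     \sum_i v ord0 i *: comb (xi (V (f i))) e.
    rewrite /comb; under [RHS]eq_bigr do rewrite scaler_sumr.
    rewrite exchange_big/=; apply: eq_bigr => j _.
    rewrite mxE scaler_suml; apply: eq_bigr => i _.
    by rewrite scalerA mxE.
  by apply: eq_bigr => i _; rewrite -xiE linearZ.
have m_near v : `|comb (v *m m) e - comb v e| <= h * `|comb v e|.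
  rewrite mE.
  have -> : P (V (comb v f)) - comb v e = P (\sum_i v ord0 i *: (V (f i) - e i)).
    under [in RHS]eq_bigr do rewrite scalerBr.
    rewrite sumrB linearB/=; congr (_ - _).
      by rewrite VS.
    rewrite linear_sum/=; apply: eq_bigr => i _.
    by rewrite linearZ/= Pe.
  apply: le_trans (le_operator_norm _ bP) _.
  have H : `|\sum_i v ord0 i *: (V (f i) - e i)| <= n%:R * K * `|comb v e| * r.
    apply: le_trans (ler_norm_sum _ _ _) _.
    apply: (@le_trans _ _ (\sum_(i < n) (K * `|comb v e| * r))).
      apply: ler_sum => i _; rewrite normrZ; apply: ler_pM => //.
    by rewrite sumr_const card_ord -[leLHS]mulr_natl !mulrA.
  apply: le_trans (ler_wpM2l p0 H) _.
  have := normr_ge0 (comb v e); move: `|comb v e| => t t0.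
  have hE : r * (n%:R * K * operator_norm P + 1) = h by rewrite /r divfK// gt_eqF.
  rewrite -hE -subr_ge0.
  rewrite (_ : _ - _ = r * t); last by ring.
  by rewrite mulr_ge0// ltW.
(* A row vector v killed by m satisfies |comb v e| <= h |comb v e| with h < 1. *)
have m_unit : m \in unitmx.
  rewrite -row_free_unit -kermx_eq0; apply/rowV0P => v /sub_kermxP vm0.
  apply: comb_inj; have := m_near v; rewrite vm0.
  have -> : comb 0 e = 0 by rewrite /comb big1// => i _; rewrite mxE scale0r.
  rewrite sub0r normrN => H; apply/normr0_eq0/eqP.
  rewrite eq_le normr_ge0 andbT leNgt; apply/negP => v0.
  by move: H; apply/negP; rewrite -ltNge gtr_pMl.
have lower v : (1 - h) * `|comb v e| <= `|comb (v *m m) e|.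
  have := m_near v; have := ler_normB (comb (v *m m) e) (comb (v *m m) e - comb v e).
  rewrite opprB addrCA subrr addr0 mulrBl mul1r; lra.
pose q x := comb (xi (V x) *m invmx m) f.
have q_lin : linear q.
  move=> a x y; rewrite /q V_lin xi_lin mulmxDl -scalemxAl; exact: combD.
pose Q : {linear X -> X} := HB.pack q (GRing.isLinear.Build R X X *:%R q q_lin).
have qf v : q (comb v f) = comb v f.
  rewrite /q; congr comb; rewrite (_ : xi _ = v *m m) ?mulmxK//.
  by apply: comb_inj; rewrite -xiE mE.
have Q_le x : `|Q x| <= operator_norm P / (1 - h) * `|x|.
  have h1' : 0 < 1 - h by rewrite subr_gt0.
  rewrite mulrAC ler_pdivlMr// mulrC.
  (* The norm is moved to the basis e by the isometry; there [lower] removes the inverse of m at the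
     cost of a factor 1 / (1 - h). *)
  rewrite [Q x]/(q x) /q -[X in _ * X <= _]ef.
  apply: le_trans (lower _) _; rewrite mulmxKV// -xiE.
  apply: le_trans (le_operator_norm _ bP) _.
  by rewrite ler_wpM2l.
exists Q; split; last first.
  by apply: operator_norm_le => //; rewrite divr_ge0// subr_ge0 ltW.
split.
- exact: linear_bounded_near Q_le.
- by move=> x; exact: qf.
apply/seteqP; split => [_ [x _ <-]|_ [c ->]].
  by exists (fun i => (xi (V x) *m invmx m) ord0 i).
exists (comb (\row_i c i) f) => //.
rewrite [LHS]qf /comb; apply: eq_bigr => i _; by rewrite mxE.
Qed.

Lemma projection_constant_transfer :
  (projection_constant (span_of f) <= (operator_norm P)%:E)%E.
Proof.
have p0 := operator_norm_ge0 bP.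
apply/lee_addgt0Pr => s s0.
(* Then |P| / (1 - h) <= |P| + s; the second s keeps h below 1 even if |P| = 0. *)
pose h := s / (operator_norm P + s + s).
have den : 0 < operator_norm P + s + s by rewrite !(ltr_wpDl, addr_ge0)// ltW.
have h01 : 0 < h < 1.
  by rewrite divr_gt0//= ltr_pdivrMr// mul1r; lra.
have [Q [Q_proj Q_le]] := projection_transfer h01.
apply: (@le_trans _ _ (operator_norm Q)%:E).
  by apply: ereal_inf_lbound; exists Q.
rewrite -EFinD lee_fin; apply: le_trans Q_le _.
case/andP: h01 => h0 h1.
rewrite ler_pdivrMr ?subr_gt0//.
have hE : h * (operator_norm P + s + s) = s by rewrite /h divfK// gt_eqF.
by nra.
Qed.

End transfer.

(** * The case p = 2 *)

Section hilbert.
Context (R : realType) (X : normedModType R) (ip : X -> X -> R).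
Hypothesis ip_linear : forall (a : R) u v w, ip (a *: u + v) w = a * ip u w + ip v w.
Hypothesis ipC : forall u v, ip u v = ip v u.
Hypothesis ip_norm : forall u, ip u u = `|u| ^+ 2.
Implicit Types (u v w : X) (q : X * X) (t : seq (X * X)).

Let ip0 w : ip 0 w = 0.
Proof.
have := ip_linear (-1) 0 0 w; rewrite scaler0 addr0 mulN1r addrC subrr.
exact.
Qed.

Let ipD u v w : ip (u + v) w = ip u w + ip v w.
Proof. by have := ip_linear 1 u v w; rewrite scale1r mul1r. Qed.

Let ipZ a u w : ip (a *: u) w = a * ip u w.
Proof. by have := ip_linear a u 0 w; rewrite ip0 !addr0. Qed.

Let ipN u w : ip (- u) w = - ip u w.
Proof. by rewrite -scaleN1r ipZ mulN1r. Qed.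

Let ip_sum (I : Type) (r : seq I) (f : I -> X) w :
  ip (\sum_(i <- r) f i) w = \sum_(i <- r) ip (f i) w.
Proof. by elim: r => [|i r IH]; rewrite ?big_nil ?ip0// !big_cons ipD IH. Qed.

(** The condition bears on first components; the second ones accompany them as images under the
    isometry. *)
Definition ortho t := (forall q, q \in t -> ip q.1 q.1 = 1) /\
  pairwise (fun q q' => ip q.1 q'.1 == 0) t.

Lemma ortho_cons q t : ortho (q :: t) ->
  [/\ ip q.1 q.1 = 1, forall q', q' \in t -> ip q'.1 q.1 = 0 & ortho t].
Proof.
move=> [t1]; rewrite pairwise_cons => /andP[/allP tq tt]; split.
- by apply: t1; rewrite mem_head.
- by move=> q' /tq /eqP; rewrite ipC.
- by split=> // q' q't; apply: t1; rewrite in_cons q't orbT.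
Qed.

Lemma ip_ortho t (c : X * X -> R) q : ortho t -> q \in t ->
  ip (\sum_(q' <- t) c q' *: q'.1) q.1 = c q.
Proof.
elim: t => // q0 t IH /ortho_cons[q1 qt ot]; rewrite in_cons big_cons.
rewrite ipD ipZ => qin.
have [qq0|qq0] := eqVneq q q0.
  rewrite qq0 q1 mulr1 ip_sum big1_seq ?addr0// => q' /andP[_ q't].
  by rewrite ipZ qt// mulr0.
move: qin; rewrite (negbTE qq0)/= => qin.
by rewrite ipC qt// mulr0 add0r IH.
Qed.

Lemma norm_ortho t (c : X * X -> R) : ortho t ->
  `|\sum_(q <- t) c q *: q.1| ^+ 2 = \sum_(q <- t) c q ^+ 2.
Proof.
rewrite -ip_norm; elim: t => [|q t IH]; first by rewrite !big_nil ip0.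
move=> /ortho_cons[q1 qt ot]; rewrite !big_cons; set S := \sum_(j <- t) _ *: _.
have Sq : ip S q.1 = 0.
  by rewrite ip_sum big1_seq// => q' /andP[_ /qt H]; rewrite ipZ H mulr0.
have E w : ip w (c q *: q.1 + S) = c q * ip w q.1 + ip w S.
  by rewrite ipC ipD ipZ ![ip _ w]ipC.
by rewrite ipD ipZ !E q1 Sq (ipC q.1 S) Sq IH//; ring.
Qed.

(** Nonnegativity of |u - S|^2, where S is the orthogonal projection of u onto the span of the first
    components. *)
Lemma bessel t u : ortho t -> \sum_(q <- t) ip u q.1 ^+ 2 <= `|u| ^+ 2.
Proof.
move=> ot; set S := \sum_(q <- t) ip u q.1 *: q.1.
have E : ip u S = \sum_(q <- t) ip u q.1 ^+ 2.
  rewrite ipC ip_sum; apply: eq_bigr => q _.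
  by rewrite ipZ [ip q.1 _]ipC expr2.
have : 0 <= ip (u - S) (u - S) by rewrite ip_norm sqr_ge0.
rewrite ipD ipN ![ip _ (u - S)]ipC !ipD !ipN [ip S u]ipC E !ip_norm norm_ortho//.
by rewrite opprB addrA subrK subr_ge0.
Qed.

(* [D] is the graph of an isometry between subspaces of [X]. *)
Variable D : X * X -> Prop.
Hypothesis D_linear : forall (a : R) q q', D q -> D q' -> D (a *: q + q').
Hypothesis D0 : D 0.
Hypothesis D_iso : forall q, D q -> `|q.1| = `|q.2|.

Let D_sum (t : seq (X * X)) (c : X * X -> R) : (forall q, q \in t -> D q) ->
  D (\sum_(q <- t) c q *: q).
Proof.
elim: t => [|q t IH] Dt; first by rewrite big_nil.
rewrite big_cons; apply: D_linear; first by apply: Dt; rewrite mem_head.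
by apply: IH => q' q't; apply: Dt; rewrite in_cons q't orbT.
Qed.

Let fst_sum t (c : X * X -> R) :
  (\sum_(q <- t) c q *: q).1 = \sum_(q <- t) c q *: q.1.
Proof. by elim: t => [|q t IH]; rewrite ?big_nil// !big_cons/= IH. Qed.

Let snd_sum t (c : X * X -> R) :
  (\sum_(q <- t) c q *: q).2 = \sum_(q <- t) c q *: q.2.
Proof. by elim: t => [|q t IH]; rewrite ?big_nil// !big_cons/= IH. Qed.

Lemma gram_schmidt (s : seq (X * X)) : (forall q, q \in s -> D q) ->
  exists t, [/\ forall q, q \in t -> D q, ortho t &
    forall q, q \in s -> q.1 = \sum_(q' <- t) ip q.1 q'.1 *: q'.1].
Proof.
elim: s => [|p s IH] Ds.
  by exists [::]; split => //; split.
have [q qs|t [Dt ot st]] := IH; first by apply: Ds; rewrite in_cons qs orbT.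
have Dp : D p by apply: Ds; rewrite mem_head.
pose c q := ip p.1 q.1.
pose r := (-1) *: (\sum_(q <- t) c q *: q) + p.
have Dr : D r by apply: D_linear => //; exact: D_sum.
have pE : p.1 = r.1 + \sum_(q <- t) c q *: q.1.
  by rewrite /r /= fst_sum scaleN1r addrAC addNr add0r.
have [r0|r0] := eqVneq r.1 0.
  exists t; split => // q; rewrite in_cons => /predU1P[->|/st//].
  by rewrite {1}pE r0 add0r.
have rn : 0 < `|r.1| by rewrite normr_gt0.
(* The [+ 0] gives q0 the shape required by [D_linear]. *)
pose q0 := `|r.1|^-1 *: r + 0.
have Dq0 : D q0 by exact: D_linear.
have q0E : q0.1 = `|r.1|^-1 *: r.1 by rewrite /q0 /= addr0.
have rt q : q \in t -> ip r.1 q.1 = 0.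
  by move=> qt; rewrite /r /= fst_sum ipD ipZ ip_ortho// mulN1r addNr.
have q0t q : q \in t -> ip q0.1 q.1 = 0.
  by move=> qt; rewrite q0E ipZ rt ?mulr0.
exists (q0 :: t); split.
- by move=> q; rewrite in_cons => /predU1P[->|/Dt].
- split.
    move=> q; rewrite in_cons => /predU1P[->|/ot.1//].
    by rewrite q0E ipZ ipC ipZ ip_norm expr2 mulKf ?gt_eqF// mulVf// gt_eqF.
  rewrite pairwise_cons ot.2 andbT; apply/allP => q qt.
  by rewrite q0t.
move=> q; rewrite in_cons => /predU1P[->|qs]; rewrite big_cons.
  rewrite -/(c q0) {1}pE; congr (_ + _).
  have pr : ip p.1 r.1 = `|r.1| ^+ 2.
    rewrite pE ipD ip_norm ip_sum big1_seq ?addr0// => q' /andP[_ q't].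
    by rewrite ipZ [ip q'.1 _]ipC rt// mulr0.
  rewrite /c q0E ipC ipZ [ip r.1 _]ipC pr scalerA.
  by rewrite (_ : _ * _ = 1) ?scale1r//; field; rewrite gt_eqF.
have -> : ip q.1 q0.1 = 0.
  rewrite (st q qs) ip_sum big1_seq// => q' /andP[_ q't].
  by rewrite ipZ [ip q'.1 _]ipC q0t// mulr0.
by rewrite scale0r add0r -st.
Qed.

(** V is the orthogonal projection onto the span of the first components followed by the isometry,
    so Bessel's inequality bounds it. *)
Lemma hilbert_contraction (s : seq (X * X)) : (forall q, q \in s -> D q) ->
  exists V : X -> X, [/\ linear V, forall u, `|V u| <= `|u| &
    forall q, q \in s -> V q.1 = q.2].
Proof.
move=> Ds; have [t [Dt ot st]] := gram_schmidt Ds.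
exists (fun u => \sum_(q <- t) ip u q.1 *: q.2); split.
- move=> a u v; rewrite scaler_sumr -big_split/=; apply: eq_bigr => q _.
  by rewrite ip_linear scalerDl scalerA.
- move=> u; have := D_iso (D_sum (fun q => ip u q.1) Dt).
  rewrite fst_sum snd_sum => <-.
  rewrite -(ler_pXn2r (n := 2))// ?nnegrE// norm_ortho//; exact: bessel.
(* The residual r lies in D and its first component is 0, so by the isometry its second component
   vanishes too. *)
move=> q qs; pose r := (-1) *: (\sum_(q' <- t) ip q.1 q'.1 *: q') + q.
have Dr : D r.
  by apply: D_linear; [exact: (D_sum (fun q' => ip q.1 q'.1))|exact: Ds].
have := D_iso Dr; rewrite /r /= fst_sum snd_sum -st// scaleN1r addNr normr0.
by move=> /esym/normr0_eq0/eqP; rewrite scaleN1r addrC subr_eq0 => /eqP.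
Qed.

End hilbert.

(** * The inner product of L_2 *)

Section L2_inner_product.
Context d (T : measurableType d) (R : realType).
Variables (mu : {measure set T -> \bar R}) (p : R) (p1 : (1 <= p%:E)%E).
Hypothesis p2 : p = 2.
Local Notation L := (LspaceType mu p1).

Definition L2_ip (u v : L) : R :=
  \int[mu]_x (Lspace_repr u x * Lspace_repr v x).

Let powRp (x : R) : 0 <= x -> x `^ p = x ^+ 2.
Proof. by move=> x0; rewrite p2 powR_mulrn. Qed.

Let mrepr (u : L) : measurable_fun setT (Lspace_repr u : T -> R).
Proof. exact: measurable_funPT. Qed.

Let ip_integrable (u v : L) : mu.-integrable setT
  (EFin \o (fun x => Lspace_repr u x * Lspace_repr v x)).
Proof.
apply: integrable_le (integrable_add (LfunType_integrable (Lspace_repr u))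
  (LfunType_integrable (Lspace_repr v))) _; first exact: measurable_funM.
move=> x; rewrite !powRp// normrM.
have := sqr_ge0 (`|Lspace_repr u x| - `|Lspace_repr v x|).
have := normr_ge0 (Lspace_repr u x); have := normr_ge0 (Lspace_repr v x); nra.
Qed.

Lemma L2_ip_linear (a : R) (u v w : L) :
  L2_ip (a *: u + v) w = a * L2_ip u w + L2_ip v w.
Proof.
rewrite /L2_ip -(RintegralZl a measurableT (ip_integrable u w)).
rewrite -(RintegralD measurableT (integrable_scale a (ip_integrable u w))
  (ip_integrable v w)).
apply: ae_eq_Rintegral; first exact: measurable_funM.
  apply: measurable_funD; last exact: measurable_funM.
  by apply: measurable_funM => //; exact: measurable_funM.
apply: filterS (Lspace_reprZD a u v) => x /= H _.
by rewrite (H I); ring.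
Qed.

Lemma L2_ipC (u v : L) : L2_ip u v = L2_ip v u.
Proof. by apply: eq_Rintegral => x _; rewrite mulrC. Qed.

Lemma L2_ip_norm (u : L) : L2_ip u u = `|u| ^+ 2.
Proof.
rewrite -powRp// -[in RHS](Lspace_reprK u) Lspace_norm_powR.
by apply: eq_Rintegral => x _; rewrite powRp// real_normK ?num_real// expr2.
Qed.

Lemma L2_contraction n (e f : 'I_n -> L) :
  (forall c : 'I_n -> R, `|\sum_i c i *: e i| = `|\sum_i c i *: f i|) ->
  exists V : L -> L, [/\ linear V, forall u, `|V u| <= `|u| &
    forall i, V (f i) = e i].
Proof.
move=> ef.
pose D (q : L * L) := exists c : 'I_n -> R,
  q = (\sum_i c i *: f i, \sum_i c i *: e i).
have D_lin (a : R) q q' : D q -> D q' -> D (a *: q + q').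
  move=> [c ->] [c' ->]; exists (fun i => a * c i + c' i).
  by congr pair => /=; rewrite scaler_sumr -big_split/=; apply: eq_bigr => i _;
    rewrite scalerDl scalerA.
have D0 : D 0.
  by exists (fun=> 0); congr pair; rewrite big1// => i _; rewrite scale0r.
have D_iso q : D q -> `|q.1| = `|q.2| by move=> [c ->] /=; rewrite ef.
have [q|V [Vl Vc Vs]] := hilbert_contraction L2_ip_linear L2_ipC L2_ip_norm
    D_lin D0 D_iso (s := [seq (f i, e i) | i <- enum 'I_n]).
  move=> /mapP[i _ ->]; exists (fun j => (j == i)%:R).
  by congr pair; rewrite (bigD1 i)//= eqxx scale1r big1 ?addr0// => j /negbTE ->;
    rewrite scale0r.
exists V; split => // i; apply: (Vs (f i, e i)).
by apply/mapP; exists i => //; rewrite mem_enum.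
Qed.

End L2_inner_product.

(** * Bases of finite-dimensional subspaces *)

Section free_family.
Context (R : realType) (X : normedModType R).

Lemma linear_subspace_comb (A : set X) n (e : 'I_n -> X) (c : 'I_n -> R) :
  linear_subspace A -> (forall i, A (e i)) -> A (\sum_i c i *: e i).
Proof.
move=> [A0 AZD] Ae; elim: (index_enum 'I_n) => [|i s IH].
  by rewrite big_nil; exact: set_mem.
rewrite big_cons; apply: set_mem; apply: AZD; exact: mem_set.
Qed.

(** A spanning family of minimal length is free: a nontrivial relation would allow one vector to be
    eliminated. *)
Lemma free_spanning_family (A : set X) : linear_subspace A -> finite_dimensional A ->
  exists n (e : 'I_n -> X), [/\ A = span_of e, forall i, A (e i) &
    forall c : 'I_n -> R, \sum_i c i *: e i = 0 -> forall i, c i = 0].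
Proof.
move=> A_sub [n0 [e0 [A0 s0]]].
pose spans n := exists e : 'I_n -> X, (forall i, A (e i)) /\
  forall x, A x -> exists c : 'I_n -> R, x = \sum_(i < n) c i *: e i.
have ex : exists n, `[< spans n >] by exists n0; apply/asboolP; exists e0.
case: (ex_minnP ex) => n /asboolP[e [Ae se]] n_min.
exists n, e; split => //.
  apply/seteqP; split => [x /se//|_ [c ->]].
  exact: linear_subspace_comb.
move=> c c0 k; apply/eqP/negPn/negP => ck.
case: n => [|m] in e Ae se n_min c c0 k ck *; first by case: k {ck}.
suff /asboolP /n_min : spans m by rewrite ltnn.
exists (fun j => e (lift k j)); split => // x /se[b ->].
(* The coordinates of x after e k is replaced by its expression from the relation c. *)
exists (fun j => b (lift k j) - b k * (c k)^-1 * c (lift k j)).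
have ek : e k = - ((c k)^-1 *: \sum_j c (lift k j) *: e (lift k j)).
  move: c0; rewrite (bigD1_ord k)//= => /eqP; rewrite addr_eq0 => /eqP.
  move=> /(congr1 (fun z => (c k)^-1 *: z)).
  by rewrite scalerA mulVf// scale1r scalerN.
rewrite (bigD1_ord k)//= {1}ek scalerN scalerA scaler_sumr addrC -sumrB.
by apply: eq_bigr => j _; rewrite scalerBl scalerA.
Qed.

Lemma isometry_family (A B : set X) n (e : 'I_n -> X) : linear_subspace A ->
  A = span_of e -> (forall i, A (e i)) -> linearly_isometric A B ->
  exists f : 'I_n -> X, B = span_of f /\
    forall c : 'I_n -> R, `|\sum_i c i *: e i| = `|\sum_i c i *: f i|.
Proof.
move=> A_sub AE Ae [U [U_lin U_iso U_B]].
have A0 : A 0 by case: A_sub => /set_mem.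
have U0 : U 0 = 0 by apply/normr0_eq0; rewrite U_iso// normr0.
have U_comb (c : 'I_n -> R) : U (\sum_i c i *: e i) = \sum_i c i *: U (e i).
  suff [//] : A (\sum_i c i *: e i) /\ U (\sum_i c i *: e i) = \sum_i c i *: U (e i).
  elim: (index_enum 'I_n) => [|i s [As Us]]; first by rewrite !big_nil.
  rewrite !big_cons; split.
    by case: A_sub => _ H; apply: set_mem; apply: H; exact: mem_set.
  by rewrite U_lin// Us.
exists (fun i => U (e i)); split; last first.
  by move=> c; rewrite -U_comb U_iso//; exact: linear_subspace_comb.
rewrite -U_B AE; apply/seteqP; split => [_ [_ [c ->] <-]|_ [c ->]].
  by exists c; rewrite U_comb.
by exists (\sum_i c i *: e i); [exists c|rewrite U_comb].
Qed.

End free_family.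

(** * Comparison of the two projection constants *)

Lemma lebesgue01_sigma_finite (R : realType) : sigma_finite setT (lebesgue01 R).
Proof.
exists (fun=> setT); first by rewrite bigcup_const.
move=> _; split => //; rewrite /= /mrestr setTI.
by rewrite lebesgue_measure_itv/= lte_fin ltr01 -EFinD ltry.
Qed.

Lemma Lp01_approx_contraction (R : realType) (p : R) (p1 : (1 <= p%:E)%E)
    (p_not_even : forall k : nat, (2 <= k)%N -> p <> (2 * k)%:R)
    n (e f : 'I_n -> Lp01 p1) (r : R) :
  (forall c : 'I_n -> R, `|\sum_i c i *: e i| = `|\sum_i c i *: f i|) -> 0 < r ->
  exists V : Lp01 p1 -> Lp01 p1, [/\ linear V, forall u, `|V u| <= `|u| &
    forall i, `|V (f i) - e i| <= r].
Proof.
move=> ef r0; have [p2|p2] := eqVneq p 2.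
  have [V [Vl Vc Vf]] := L2_contraction p2 ef; exists V; split => // i.
  by rewrite Vf subrr normr0 ltW.
apply: approx_contraction => //; last exact: lebesgue01_sigma_finite.
move=> m; apply/eqP => pm.
have {}pm : p = (2 * m)%:R by rewrite natrM -pm mulrCA divff ?mulr1.
(* m = 0 contradicts p >= 1, m = 1 is the case p = 2 already treated, and m >= 2 is excluded by
   [p_not_even]. *)
case: m pm => [|[|m]] pm; last exact: (p_not_even m.+2).
- by have := p1; rewrite lee_fin pm muln0 ler10.
- by rewrite pm muln1 eqxx in p2.
Qed.

(** Each projection onto the span of e bounds the left-hand side by transfer; if there is none, the
    right-hand side is +oo. *)
Lemma projection_constant_le (R : realType) (p : R) (p1 : (1 <= p%:E)%E)
    (p_not_even : forall k : nat, (2 <= k)%N -> p <> (2 * k)%:R)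
    n (e f : 'I_n -> Lp01 p1) :
  (forall c : 'I_n -> R, \sum_i c i *: e i = 0 -> forall i, c i = 0) ->
  (forall c : 'I_n -> R, `|\sum_i c i *: e i| = `|\sum_i c i *: f i|) ->
  (projection_constant (span_of f) <= projection_constant (span_of e))%E.
Proof.
move=> e_free ef; apply: le_ereal_inf_tmp => _ [P P_proj <-].
apply: (projection_constant_transfer e_free ef _ P_proj) => r r0.
exact: Lp01_approx_contraction.
Qed.

Theorem corollary5 (R : realType) (p : R) (p1 : (1 <= p%:E)%E)
    (p_not_even : forall k : nat, (2 <= k)%N -> p <> (2 * k)%:R)
    (A B : set (Lp01 p1))
    (A_sub : linear_subspace A) (A_fin : finite_dimensional A)
    (B_sub : linear_subspace B) (B_fin : finite_dimensional B)
    (AB_iso : linearly_isometric A B) :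
  projection_constant A = projection_constant B.
Proof.
have [n [e [AE Ae e_free]]] := free_spanning_family A_sub A_fin.
have [f [BE ef]] := isometry_family A_sub AE Ae AB_iso.
(* Equality of norms carries freeness over to f, so the same inequality applies with e and f
   exchanged. *)
have f_free (c : 'I_n -> R) : \sum_i c i *: f i = 0 -> forall i, c i = 0.
  move=> /(congr1 Num.norm); rewrite -ef normr0 => /normr0_eq0.
  exact: e_free.
apply/eqP; rewrite eq_le AE BE; apply/andP; split.
  by apply: projection_constant_le => // c; rewrite ef.
exact: projection_constant_le.
Qed.
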